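(* Let $m\ge0$ be an integer, let $h(z)=\sum_{n\ge m}c_nz^n$, and let $T=A^{m,-m}_h$, where $|c_n|\le|c_{n+1}|$ for all $n\ge m$. Let $f(z)=\sum_{n\ge m}a_nz^n$ and $g(z)=\sum_{n\ge m}b_nz^n$ be such that $Tf$ and $Tg$ are analytic in $\mathbb{D}$. If $|Tf(z)|\le|Tg(z)|$ for all $z\in\mathbb{D}$, then $$M_rf\le M_r(Tg),\qquad 0\le r\le R_{T\to id}.$$ The number $R_{T\to id}$ is best possible: for the given $T$, it cannot be replaced by any larger number so that the inequality remains valid for all such pairs $f,g$.
   Context: $\mathbb{D}$ is the open unit disk and $\|u\|_\infty=\sup_{z\in\mathbb{D}}|u(z)|$. For a power series $u(z)=\sum_nu_nz^n$, the majorant series is $M_ru=\sum_n|u_n|r^n\in[0,\infty]$. All power series $f=\sum_{n\ge m}a_nz^n$ considered converge in some disk $t\mathbb{D}$, $t>0$, and $$Tf(z)=A^{m,-m}_hf(z)=z^{-m}(h\ast f)(z)=\sum_{n\ge m}c_na_nz^{n-m};$$ in particular $M_r(Tg)=\sum_{n\ge m}|c_nb_n|r^{n-m}$. The Bohr radius $R_{T\to id}$ is the maximal $R\in[0,\infty)$ such that for every $f=\sum_{n\ge m}a_nz^n$ for which $Tf$ converges in $\mathbb{D}$ and $\|Tf\|_\infty\le1$, one has $M_rf\le1$ for all $0\le r\le R$. It is tacitly assumed that such an $R$ exists (i.e. that $R=0$ is admissible). *)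

(* Defs.v *)
(* Stdlib real numbers with Coquelicot. *)
From Stdlib Require Import Reals.
From Coquelicot Require Import Coquelicot.

Local Open Scope R_scope.

(* A power series sum_n u_n z^n is its coefficient sequence u : nat -> C;
   a series sum_{n >= m} u_n z^n is one whose coefficients below m vanish. *)
Definition starts_at (m : nat) (u : nat -> C) : Prop :=
  forall n : nat, (n < m)%nat -> u n = RtoC 0.

Definition converges_in_disk (t : R) (u : nat -> C) : Prop :=
  forall z : C, Cmod z < t ->
    exists w : C, @is_pseries C_AbsRing C_NormedModule u z w.

Definition convergent (u : nat -> C) : Prop :=
  exists t : R, 0 < t /\ converges_in_disk t u.

(* The sum of the series at z; meaningful only where the series converges. *)
Definition ps_eval (u : nat -> C) (z : C) : C :=
  @iota C_CompleteNormedModule (@is_pseries C_AbsRing C_NormedModule u z).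

Definition sup_norm (u : nat -> C) : Rbar :=
  Lub_Rbar (fun x : R => exists z : C, Cmod z < 1 /\ x = Cmod (ps_eval u z)).

(* For r >= 0 the partial sums are nondecreasing, so [Lim_seq] is their limit
   in [0, +oo]; the value is [p_infty] when the majorant series diverges. *)
Definition majorant_series (r : R) (u : nat -> C) : Rbar :=
  Lim_seq (sum_n (fun n : nat => Cmod (u n) * r ^ n)).

Definition hadamard (h f : nat -> C) : nat -> C :=
  fun n : nat => Cmult (h n) (f n).

(* A_h^{m,-m} f = z^{-m} (h * f). *)
Definition opA (m : nat) (h f : nat -> C) : nat -> C :=
  fun n : nat => hadamard h f (n + m)%nat.

Definition bohr_admissible (m : nat) (h : nat -> C) (R0 : R) : Prop :=
  forall f : nat -> C,
    starts_at m f -> convergent f ->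
    converges_in_disk 1 (opA m h f) ->
    Rbar_le (sup_norm (opA m h f)) (Finite 1) ->
    forall r : R, 0 <= r <= R0 -> Rbar_le (majorant_series r f) (Finite 1).

(* R0 is the Bohr radius R_{T -> id} of T = A_h^{m,-m}. *)
Definition is_bohr_radius (m : nat) (h : nat -> C) (R0 : R) : Prop :=
  0 <= R0 /\ bohr_admissible m h R0 /\
  forall R1 : R, 0 <= R1 -> bohr_admissible m h R1 -> R1 <= R0.

Definition dominated_pair (m : nat) (h f g : nat -> C) : Prop :=
  starts_at m f /\ starts_at m g /\ convergent f /\ convergent g /\
  converges_in_disk 1 (opA m h f) /\ converges_in_disk 1 (opA m h g) /\
  forall z : C, Cmod z < 1 ->
    Cmod (ps_eval (opA m h f) z) <= Cmod (ps_eval (opA m h g) z).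

(* Main.v *)
Require Import Defs.
From Stdlib Require Import Reals Lra Lia Classical.
From Coquelicot Require Import Coquelicot.

Local Open Scope R_scope.

(** Write F = Tf and G = Tg. Since |F| <= |G| in the disk, F = phi G with phi
    analytic in the disk and |phi| <= 1. If h m <> 0, all coefficients of h from
    degree m on are nonzero, and phi = T k for the series k with coefficients
    phi_j / h_(j+m). By definition of the Bohr radius the majorant series of k
    is at most 1 for r <= R0. The moduli |h_n| increase, so the coefficients of
    f are dominated by those of the Cauchy product of the majorant series of k
    and of G, and M_r f <= M_r k * M_r G <= M_r G ([majorant_dominated]). If
    h m = 0, then T annihilates z^m, which forces m > 0 and R0 = 0, and M_0 f
    is 0.

    For the sharpness, if h m <> 0 take g = z^m / h m: then Tg = 1 and the
    inequality for the pairs (f, g) says exactly that R1 is admissible in the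
    definition of the Bohr radius. If h m = 0, take f = z^m and g = 0.

    The function phi is obtained on coefficient sequences
    ([schur_quotient_exists]), as the formal quotient of F by G; the point is
    that it converges in the whole disk. If G has no zero in a closed disk, its
    formal reciprocal is continued from radius 0 by steps of fixed length: at
    each step a geometric series converges thanks to Cauchy's estimate for the
    coefficients, and the lower bound of |G| bounds the reciprocal again
    ([inverse_of_zero_free]). The zeros of G are zeros of F and are exchanged
    for zeros outside the disk: replacing z - w by 1 - conj(w) z in F and in G
    leaves the quotient unchanged, preserves the sum of the squares of the
    moduli of the coefficients of G and increases |G(0)|, which that sum
    bounds; so finitely many replacements suffice
    ([schur_quotient_radius_gt1]). *)

(** * Absolutely convergent complex series *)

(** The two real series make the sum a total function; it is the sum of the
    complex series as soon as [abs_summable a] holds. *)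
Definition csum (a : nat -> C) : C :=
  (Series (fun n => Re (a n)), Series (fun n => Im (a n))).

Definition abs_summable (a : nat -> C) : Prop := ex_series (fun n => Cmod (a n)).

Lemma im_le_Cmod (c : C) : Rabs (Im c) <= Cmod c.
Proof.
  apply Rle_trans with (2 := Rmax_Cmod c). apply Rmax_r.
Qed.

Lemma C_ext (a b : C) : Re a = Re b -> Im a = Im b -> a = b.
Proof. destruct a, b; simpl; congruence. Qed.

Lemma ex_series_dom (a b : nat -> R) :
  (forall n, Rabs (a n) <= b n) -> ex_series b -> ex_series a.
Proof. intros H Hb. apply (@ex_series_le R_AbsRing R_CompleteNormedModule) with b; auto. Qed.

Lemma ex_series_eq (a b : nat -> R) : (forall n, a n = b n) -> ex_series a -> ex_series b.
Proof. apply ex_series_ext. Qed.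

Lemma abs_summable_dom (a : nat -> C) (b : nat -> R) :
  (forall n, Cmod (a n) <= b n) -> ex_series b -> abs_summable a.
Proof.
  intros H Hb. apply ex_series_dom with b; auto.
  intros n. rewrite Rabs_pos_eq; auto. apply Cmod_ge_0.
Qed.

Lemma ex_series_Rabs_Re (a : nat -> C) :
  abs_summable a -> ex_series (fun n => Rabs (Re (a n))).
Proof.
  apply ex_series_dom. intros n. rewrite Rabs_Rabsolu. apply re_le_Cmod.
Qed.

Lemma ex_series_Rabs_Im (a : nat -> C) :
  abs_summable a -> ex_series (fun n => Rabs (Im (a n))).
Proof.
  apply ex_series_dom. intros n. rewrite Rabs_Rabsolu. apply im_le_Cmod.
Qed.

Lemma ex_series_Re (a : nat -> C) : abs_summable a -> ex_series (fun n => Re (a n)).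
Proof. intros H. apply ex_series_Rabs, ex_series_Rabs_Re, H. Qed.

Lemma ex_series_Im (a : nat -> C) : abs_summable a -> ex_series (fun n => Im (a n)).
Proof. intros H. apply ex_series_Rabs, ex_series_Rabs_Im, H. Qed.

Lemma csum_ext (a b : nat -> C) : (forall n, a n = b n) -> csum a = csum b.
Proof.
  intros H. unfold csum. f_equal; apply Series_ext; intros n; rewrite H; reflexivity.
Qed.

Lemma csum_plus (a b : nat -> C) : abs_summable a -> abs_summable b ->
  csum (fun n => a n + b n)%C = (csum a + csum b)%C.
Proof.
  intros Ha Hb. unfold csum. apply C_ext; simpl.
  - rewrite <- Series_plus by (apply ex_series_Re; assumption). reflexivity.
  - rewrite <- Series_plus by (apply ex_series_Im; assumption). reflexivity.
Qed.

Lemma csum_scal (c : C) (a : nat -> C) : abs_summable a ->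
  csum (fun n => c * a n)%C = (c * csum a)%C.
Proof.
  intros Ha. pose proof (ex_series_Re a Ha). pose proof (ex_series_Im a Ha).
  assert (E : forall (k : R) (x : nat -> R), ex_series x -> ex_series (fun n => k * x n)).
  { intros k x Hx. exact (@ex_series_scal R_AbsRing R_NormedModule k x Hx). }
  unfold csum. apply C_ext; simpl; rewrite <- !Series_scal_l.
  - rewrite <- Series_minus by (apply E; assumption). reflexivity.
  - rewrite <- Series_plus by (apply E; assumption). reflexivity.
Qed.

Lemma csum_head (a : nat -> C) : abs_summable a ->
  csum a = (a 0%nat + csum (fun n => a (S n)))%C.
Proof.
  intros Ha. unfold csum. apply C_ext; simpl.
  - rewrite Series_incr_1 by (apply ex_series_Re; assumption). reflexivity.
  - rewrite Series_incr_1 by (apply ex_series_Im; assumption). reflexivity.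
Qed.

Lemma Series_nonneg (a : nat -> R) : (forall n, 0 <= a n) -> ex_series a -> 0 <= Series a.
Proof.
  intros Ha E. rewrite <- (Rmult_0_l (Series a)), <- Series_scal_l.
  apply Series_le; auto. intros n. specialize (Ha n). lra.
Qed.

(** Multiplying by the conjugate of the sum turns its modulus into the real
    part of a series, to which the real triangle inequality applies. *)
Lemma Cmod_csum_le (a : nat -> C) : abs_summable a ->
  Cmod (csum a) <= Series (fun n => Cmod (a n)).
Proof.
  intros Ha. set (S0 := csum a).
  destruct (Req_dec (Cmod S0) 0) as [E|E].
  { rewrite E. apply Series_nonneg; auto. intros; apply Cmod_ge_0. }
  assert (0 < Cmod S0) by (pose proof (Cmod_ge_0 S0); lra).
  apply Rmult_le_reg_l with (Cmod S0); auto.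
  assert (E2 : Cmod S0 * Cmod S0 = Re (csum (fun n => Cconj S0 * a n)%C)).
  { rewrite csum_scal by assumption. fold S0.
    pose proof (Cmod2_alt S0). rewrite re_mult, re_conj, im_conj.
    replace (Cmod S0 * Cmod S0) with (Cmod S0 ^ 2) by ring. rewrite H0. ring. }
  rewrite E2, <- Series_scal_l. simpl.
  eapply Rle_trans; [apply Rle_abs|].
  assert (Hx : ex_series (fun n => Cmod S0 * Cmod (a n))).
  { exact (@ex_series_scal R_AbsRing R_NormedModule (Cmod S0) _ Ha). }
  assert (Hle : forall n, Rabs (fst (Cconj S0 * a n)%C) <= Cmod S0 * Cmod (a n)).
  { intros n. rewrite <- (Cmod_conj S0), <- Cmod_mult. apply re_le_Cmod. }
  eapply Rle_trans; [apply Series_Rabs|].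
  - apply ex_series_dom with (2 := Hx). intros n. rewrite Rabs_Rabsolu. apply Hle.
  - apply Series_le; auto. intros n; split; [apply Rabs_pos | apply Hle].
Qed.

(** * Formal power series *)

Definition tl {A : Type} (u : nat -> A) : nat -> A := fun n => u (S n).

(** The coefficients of a product of power series. Recursion on the head of [a]
    makes the ring laws one-step inductions, with no manipulation of indices;
    [convR_sum] relates it to the usual convolution formula. *)
Fixpoint conv (a b : nat -> C) (n : nat) {struct n} : C :=
  match n with
  | O => (a O * b O)%C
  | S p => (a O * b (S p) + conv (tl a) b p)%C
  end.

Fixpoint convR (a b : nat -> R) (n : nat) {struct n} : R :=
  match n with
  | O => a O * b O
  | S p => a O * b (S p) + convR (tl a) b p
  end.

Definition ps_one : nat -> C := fun n => match n with O => RtoC 1 | S _ => RtoC 0 end.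

Lemma conv_ext (a a' b b' : nat -> C) :
  (forall n, a n = a' n) -> (forall n, b n = b' n) -> forall n, conv a b n = conv a' b' n.
Proof.
  intros Ha Hb n. revert a a' Ha. induction n as [|n IH]; intros a a' Ha; simpl.
  - rewrite Ha, Hb. reflexivity.
  - rewrite Ha, Hb, (IH (tl a) (tl a')); [reflexivity|]. intros k; apply Ha.
Qed.

Lemma conv_plus_l (a a' b : nat -> C) (n : nat) :
  conv (fun k => a k + a' k)%C b n = (conv a b n + conv a' b n)%C.
Proof.
  revert a a'. induction n as [|n IH]; intros a a'; simpl; [ring|].
  change (tl (fun k => (a k + a' k)%C)) with (fun k => (tl a k + tl a' k)%C).
  rewrite IH. ring.
Qed.

Lemma conv_scal_l (c : C) (a b : nat -> C) (n : nat) :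
  conv (fun k => c * a k)%C b n = (c * conv a b n)%C.
Proof.
  revert a. induction n as [|n IH]; intros a; simpl; [ring|].
  change (tl (fun k => (c * a k)%C)) with (fun k => (c * tl a k)%C).
  rewrite IH. ring.
Qed.

(** The mirror image of the recursive definition, from which commutativity
    follows. *)
Lemma conv_last (a b : nat -> C) (n : nat) :
  conv a b (S n) = (conv a (tl b) n + a (S n) * b O)%C.
Proof.
  revert a. induction n as [|n IH]; intros a.
  - reflexivity.
  - change (conv a b (S (S n))) with (a O * b (S (S n)) + conv (tl a) b (S n))%C.
    rewrite IH. simpl. unfold tl. ring.
Qed.

Lemma conv_comm (a b : nat -> C) (n : nat) : conv a b n = conv b a n.
Proof.
  revert a b. induction n as [|n IH]; intros a b.
  - simpl; ring.
  - rewrite conv_last. simpl. rewrite IH. ring.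
Qed.

Lemma conv_assoc (a b c : nat -> C) (n : nat) :
  conv (conv a b) c n = conv a (conv b c) n.
Proof.
  revert a. induction n as [|n IH]; intros a; simpl.
  - ring.
  - rewrite (conv_ext (tl (conv a b)) (fun k => a O * tl b k + conv (tl a) b k)%C c c)
      by (intros; reflexivity).
    rewrite conv_plus_l, conv_scal_l, IH. ring.
Qed.

Lemma conv_plus_r (a b b' : nat -> C) (n : nat) :
  conv a (fun k => b k + b' k)%C n = (conv a b n + conv a b' n)%C.
Proof. rewrite !(conv_comm a). apply conv_plus_l. Qed.

Lemma conv_scal_r (c : C) (a b : nat -> C) (n : nat) :
  conv a (fun k => c * b k)%C n = (c * conv a b n)%C.
Proof. rewrite !(conv_comm a). apply conv_scal_l. Qed.

Lemma conv_ps_one_l (a : nat -> C) (n : nat) : conv ps_one a n = a n.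
Proof.
  assert (Z : forall k, conv (fun _ => RtoC 0) a k = RtoC 0).
  { intros k. induction k as [|k IH]; simpl; [ring|].
    change (tl (fun _ : nat => RtoC 0)) with (fun _ : nat => RtoC 0). rewrite IH. ring. }
  destruct n; simpl; [ring|].
  change (tl ps_one) with (fun _ : nat => RtoC 0). rewrite Z. ring.
Qed.

Lemma conv_ps_one_r (a : nat -> C) (n : nat) : conv a ps_one n = a n.
Proof. rewrite conv_comm. apply conv_ps_one_l. Qed.

Lemma conv_re (a b : nat -> C) (n : nat) :
  Re (conv a b n) = convR (fun k => Re (a k)) (fun k => Re (b k)) n
                    - convR (fun k => Im (a k)) (fun k => Im (b k)) n.
Proof.
  revert a. induction n as [|n IH]; intros a; simpl conv; simpl convR.
  - apply re_mult.
  - rewrite re_plus, re_mult, IH. unfold tl. ring.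
Qed.

Lemma conv_im (a b : nat -> C) (n : nat) :
  Im (conv a b n) = convR (fun k => Re (a k)) (fun k => Im (b k)) n
                    + convR (fun k => Im (a k)) (fun k => Re (b k)) n.
Proof.
  revert a. induction n as [|n IH]; intros a; simpl conv; simpl convR.
  - apply im_mult.
  - rewrite im_plus, im_mult, IH. unfold tl. ring.
Qed.

Lemma convR_sum (a b : nat -> R) (n : nat) :
  convR a b n = sum_f_R0 (fun k => a k * b (n - k)%nat) n.
Proof.
  revert a. induction n as [|n IH]; intros a; simpl convR.
  - reflexivity.
  - rewrite decomp_sum by lia. simpl pred. rewrite IH. reflexivity.
Qed.

Lemma Cmod_conv_le (a b : nat -> C) (n : nat) :
  Cmod (conv a b n) <= convR (fun k => Cmod (a k)) (fun k => Cmod (b k)) n.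
Proof.
  revert a. induction n as [|n IH]; intros a; simpl.
  - rewrite Cmod_mult. lra.
  - eapply Rle_trans; [apply Cmod_triangle|]. rewrite Cmod_mult.
    apply Rplus_le_compat_l. apply IH.
Qed.

Lemma is_series_convR (a b : nat -> R) :
  ex_series (fun n => Rabs (a n)) -> ex_series (fun n => Rabs (b n)) ->
  is_series (convR a b) (Series a * Series b).
Proof.
  intros Ha Hb.
  apply is_series_ext with (fun n => sum_f_R0 (fun k => a k * b (n - k)%nat) n).
  { intros n; symmetry; apply convR_sum. }
  apply is_series_mult; auto; apply Series_correct, ex_series_Rabs; auto.
Qed.

Lemma abs_summable_conv (a b : nat -> C) :
  abs_summable a -> abs_summable b -> abs_summable (conv a b).
Proof.
  intros Ha Hb.
  assert (Ha' : ex_series (fun n => Rabs (Cmod (a n)))).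
  { apply ex_series_dom with (2 := Ha). intros n. rewrite Rabs_Rabsolu, Rabs_pos_eq; [lra|apply Cmod_ge_0]. }
  assert (Hb' : ex_series (fun n => Rabs (Cmod (b n)))).
  { apply ex_series_dom with (2 := Hb). intros n. rewrite Rabs_Rabsolu, Rabs_pos_eq; [lra|apply Cmod_ge_0]. }
  apply abs_summable_dom with (1 := Cmod_conv_le a b).
  eexists. apply (is_series_convR _ _ Ha' Hb').
Qed.

(** Mertens' theorem in the absolutely convergent case, obtained from the
    four real products of real and imaginary parts. *)
Lemma csum_conv (a b : nat -> C) : abs_summable a -> abs_summable b ->
  csum (conv a b) = (csum a * csum b)%C.
Proof.
  intros Ha Hb.
  pose proof (ex_series_Rabs_Re a Ha) as Ra. pose proof (ex_series_Rabs_Im a Ha) as Ia.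
  pose proof (ex_series_Rabs_Re b Hb) as Rb. pose proof (ex_series_Rabs_Im b Hb) as Ib.
  pose proof (is_series_convR _ _ Ra Rb) as RR. pose proof (is_series_convR _ _ Ia Ib) as II.
  pose proof (is_series_convR _ _ Ra Ib) as RI. pose proof (is_series_convR _ _ Ia Rb) as IR.
  unfold csum. apply C_ext; simpl.
  - rewrite <- (is_series_unique _ _ RR), <- (is_series_unique _ _ II).
    rewrite <- Series_minus by (eexists; eassumption).
    apply Series_ext; intros n. apply conv_re.
  - rewrite <- (is_series_unique _ _ RI), <- (is_series_unique _ _ IR).
    rewrite <- Series_plus by (eexists; eassumption).
    apply Series_ext; intros n. apply conv_im.
Qed.

(** * Evaluation of power series *)

Definition summ_at (r : R) (u : nat -> C) : Prop :=
  ex_series (fun n => Cmod (u n) * r ^ n).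

Definition analytic_in (t : R) (u : nat -> C) : Prop :=
  forall r : R, 0 <= r < t -> summ_at r u.

Definition ev (u : nat -> C) (z : C) : C := csum (fun n => u n * z ^ n)%C.

(** The coefficients of the function z |-> u (t z). *)
Definition scl (t : R) (u : nat -> C) : nat -> C := fun n => (u n * RtoC t ^ n)%C.

Lemma ex_series_scal_R (c : R) (a : nat -> R) : ex_series a -> ex_series (fun n => c * a n).
Proof. intros H. exact (@ex_series_scal R_AbsRing R_NormedModule c a H). Qed.

Lemma ex_series_plus_R (a b : nat -> R) :
  ex_series a -> ex_series b -> ex_series (fun n => a n + b n).
Proof. intros H K. exact (@ex_series_plus R_AbsRing R_NormedModule a b H K). Qed.

Lemma term_ge_0 (u : nat -> C) (r : R) (n : nat) : 0 <= r -> 0 <= Cmod (u n) * r ^ n.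
Proof. intros H. apply Rmult_le_pos; [apply Cmod_ge_0 | apply pow_le; auto]. Qed.

Lemma summ_at_terms (u : nat -> C) (z : C) :
  summ_at (Cmod z) u -> abs_summable (fun n => u n * z ^ n)%C.
Proof.
  intros H. apply abs_summable_dom with (2 := H).
  intros n. rewrite Cmod_mult, Cmod_pow. lra.
Qed.

Lemma summ_at_dom (u v : nat -> C) (K r r' : R) :
  0 <= r -> (forall n, Cmod (u n) * r ^ n <= K * (Cmod (v n) * r' ^ n)) ->
  summ_at r' v -> summ_at r u.
Proof.
  intros Hr H Hv. apply ex_series_dom with (2 := ex_series_scal_R K _ Hv).
  intros n. rewrite Rabs_pos_eq; auto. apply term_ge_0; auto.
Qed.

Lemma summ_at_0 (u : nat -> C) : summ_at 0 u.
Proof.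
  apply ex_series_dom with (fun n => Cmod (u 0%nat) * 0 ^ n).
  - intros [|n]; simpl; [rewrite Rabs_pos_eq; [lra|]|rewrite Rmult_0_l, !Rmult_0_r, Rabs_R0; lra].
    rewrite Rmult_1_r; apply Cmod_ge_0.
  - apply ex_series_scal_R, ex_series_geom. rewrite Rabs_R0; lra.
Qed.

Lemma summ_at_tail (u : nat -> C) (r : R) : 0 <= r -> summ_at r u -> summ_at r (tl u).
Proof.
  intros Hr H. destruct (Req_dec r 0) as [->|Hr0].
  - apply summ_at_0.
  - apply ex_series_dom with (fun n => / r * (Cmod (u (S n)) * r ^ (S n))).
    + intros n. rewrite Rabs_pos_eq by (apply term_ge_0; auto).
      simpl. right. unfold tl. field. auto.
    + apply ex_series_scal_R.
      apply (ex_series_incr_1 (fun n => Cmod (u n) * r ^ n)); exact H.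
Qed.

(** Comparison with a geometric series; this is how every power series below
    is shown to converge. *)
Lemma analytic_in_bounded (u : nat -> C) (t B : R) : 0 < t ->
  (forall n, Cmod (u n) * t ^ n <= B) -> analytic_in t u.
Proof.
  intros Ht H r Hr.
  apply ex_series_dom with (fun n => B * (r / t) ^ n).
  - intros n. rewrite Rabs_pos_eq by (apply term_ge_0; lra).
    assert (E : r ^ n = t ^ n * (r / t) ^ n).
    { rewrite <- Rpow_mult_distr. f_equal. field. lra. }
    rewrite E, <- Rmult_assoc. apply Rmult_le_compat_r; auto.
    apply pow_le. apply Rdiv_le_0_compat; lra.
  - apply ex_series_scal_R, ex_series_geom.
    rewrite Rabs_pos_eq by (apply Rdiv_le_0_compat; lra).
    apply Rmult_lt_reg_r with t; auto. unfold Rdiv. rewrite Rmult_assoc, Rinv_l; lra.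
Qed.

Lemma ex_series_bounded (a : nat -> R) : ex_series a -> exists B, forall n, Rabs (a n) <= B.
Proof.
  intros H. apply ex_series_lim_0 in H.
  destruct (filterlim_bounded a) as [M HM].
  { exists 0. exact H. }
  exists M. exact HM.
Qed.

Lemma sum_n_Re (a : nat -> C) (n : nat) :
  Re (@sum_n C_AbelianMonoid a n) = sum_n (fun k => Re (a k)) n.
Proof.
  induction n as [|n IH].
  - rewrite !sum_O. reflexivity.
  - rewrite !sum_Sn, <- IH. reflexivity.
Qed.

Lemma sum_n_Im (a : nat -> C) (n : nat) :
  Im (@sum_n C_AbelianMonoid a n) = sum_n (fun k => Im (a k)) n.
Proof.
  induction n as [|n IH].
  - rewrite !sum_O. reflexivity.
  - rewrite !sum_Sn, <- IH. reflexivity.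
Qed.

Lemma is_series_C (a : nat -> C) (w : C) :
  @is_series C_AbsRing C_NormedModule a w <->
  is_series (fun n => Re (a n)) (Re w) /\ is_series (fun n => Im (a n)) (Im w).
Proof.
  unfold is_series. split.
  - intros H. split.
    + apply filterlim_ext with (fun n => Re (@sum_n C_AbelianMonoid a n)); [apply sum_n_Re|].
      apply filterlim_locally. intros eps.
      assert (K := proj1 (filterlim_locally _ _) H eps). revert K.
      apply filter_imp. intros n Hn. apply Hn.
    + apply filterlim_ext with (fun n => Im (@sum_n C_AbelianMonoid a n)); [apply sum_n_Im|].
      apply filterlim_locally. intros eps.
      assert (K := proj1 (filterlim_locally _ _) H eps). revert K.
      apply filter_imp. intros n Hn. apply Hn.
  - intros [H1 H2]. apply filterlim_locally. intros eps.
    assert (K1 := proj1 (filterlim_locally _ _) H1 eps).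
    assert (K2 := proj1 (filterlim_locally _ _) H2 eps).
    generalize (filter_and _ _ K1 K2). apply filter_imp. intros n [Hn1 Hn2].
    rewrite <- sum_n_Re in Hn1. rewrite <- sum_n_Im in Hn2. split; assumption.
Qed.

Lemma pow_n_C (z : C) (n : nat) : @pow_n C_Ring z n = (z ^ n)%C.
Proof. induction n as [|n IH]; [reflexivity|]. simpl. rewrite IH. reflexivity. Qed.

Lemma is_pseries_C (u : nat -> C) (z w : C) :
  @is_pseries C_AbsRing C_NormedModule u z w <->
  @is_series C_AbsRing C_NormedModule (fun n => u n * z ^ n)%C w.
Proof.
  assert (E : forall n, @scal C_AbsRing C_NormedModule (@pow_n C_AbsRing z n) (u n) = (u n * z ^ n)%C).
  { intros n. rewrite <- pow_n_C. apply Cmult_comm. }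
  split; apply is_series_ext; intros n; [apply E | symmetry; apply E].
Qed.

Lemma is_pseries_ev (u : nat -> C) (z : C) : summ_at (Cmod z) u ->
  @is_pseries C_AbsRing C_NormedModule u z (ev u z).
Proof.
  intros H. apply summ_at_terms in H. apply is_pseries_C, is_series_C. split.
  - apply Series_correct, ex_series_Re, H.
  - apply Series_correct, ex_series_Im, H.
Qed.

Lemma ps_eval_ev (u : nat -> C) (z : C) : summ_at (Cmod z) u -> ps_eval u z = ev u z.
Proof.
  intros H. apply is_pseries_ev in H. unfold ps_eval. apply (@iota_unique C_AbsRing C_CompleteNormedModule); auto.
  intros y Hy. apply is_pseries_C, is_series_C in Hy. apply is_pseries_C, is_series_C in H.
  destruct Hy as [H1 H2], H as [H3 H4]. apply C_ext.
  - rewrite <- (is_series_unique _ _ H1). apply (is_series_unique _ _ H3).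
  - rewrite <- (is_series_unique _ _ H2). apply (is_series_unique _ _ H4).
Qed.

(** Convergence at a point of modulus between r and t bounds the terms there,
    hence gives absolute convergence at r (Abel). *)
Lemma converges_analytic (t : R) (u : nat -> C) :
  converges_in_disk t u <-> analytic_in t u.
Proof.
  split.
  - intros H r Hr. set (s := (r + t) / 2).
    assert (Hs : Rabs s = s) by (apply Rabs_pos_eq; unfold s; lra).
    destruct (H (RtoC s)) as [w Hw].
    { rewrite Cmod_R, Hs. unfold s; lra. }
    apply is_pseries_C, is_series_C in Hw. destruct Hw as [H1 H2].
    destruct (ex_series_bounded _ (ex_intro _ _ H1)) as [B1 HB1].
    destruct (ex_series_bounded _ (ex_intro _ _ H2)) as [B2 HB2].
    apply (analytic_in_bounded u s (B1 + B2)); [unfold s; lra| |unfold s; lra].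
    intros n. specialize (HB1 n). specialize (HB2 n). cbv beta in HB1, HB2.
    set (x := (u n * RtoC s ^ n)%C) in *.
    assert (Ex : Cmod (u n) * s ^ n = Cmod x).
    { unfold x. rewrite Cmod_mult, Cmod_pow, Cmod_R, Hs. reflexivity. }
    rewrite Ex. replace x with (RtoC (Re x) + Ci * RtoC (Im x))%C.
    2: { apply C_ext; simpl; ring. }
    eapply Rle_trans; [apply Cmod_triangle|].
    rewrite Cmod_mult, Cmod_Ci, !Cmod_R. lra.
  - intros H z Hz. exists (ev u z). apply is_pseries_ev, H.
    split; [apply Cmod_ge_0|auto].
Qed.

Lemma conv_scl_C (z : C) (u v : nat -> C) (n : nat) :
  conv (fun k => u k * z ^ k)%C (fun k => v k * z ^ k)%C n = (conv u v n * z ^ n)%C.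
Proof.
  revert u. induction n as [|n IH]; intros u; simpl; [ring|].
  rewrite (conv_ext _ (fun k => z * (tl u k * z ^ k))%C _ (fun k => v k * z ^ k)%C).
  - rewrite conv_scal_l, IH. ring.
  - intros k. unfold tl. simpl. ring.
  - reflexivity.
Qed.

Lemma summ_at_conv (r : R) (u v : nat -> C) : 0 <= r ->
  summ_at r u -> summ_at r v -> summ_at r (conv u v).
Proof.
  intros Hr. rewrite <- (Rabs_pos_eq r), <- Cmod_R by auto. intros Hu Hv.
  apply summ_at_terms in Hu, Hv.
  apply ex_series_ext with (2 := abs_summable_conv _ _ Hu Hv).
  intros n. rewrite conv_scl_C, Cmod_mult, Cmod_pow. reflexivity.
Qed.

Lemma ev_conv (u v : nat -> C) (z : C) : summ_at (Cmod z) u -> summ_at (Cmod z) v ->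
  ev (conv u v) z = (ev u z * ev v z)%C.
Proof.
  intros Hu Hv. apply summ_at_terms in Hu, Hv. unfold ev.
  rewrite <- csum_conv by assumption. apply csum_ext. intros n. symmetry. apply conv_scl_C.
Qed.

Lemma ev_ext (u v : nat -> C) (z : C) : (forall n, u n = v n) -> ev u z = ev v z.
Proof. intros H. apply csum_ext. intros n. rewrite H. reflexivity. Qed.

Lemma summ_at_ext (r : R) (u v : nat -> C) : (forall n, u n = v n) -> summ_at r u -> summ_at r v.
Proof. intros H. apply ex_series_ext. intros n. rewrite H. reflexivity. Qed.

Lemma summ_at_plus (r : R) (u v : nat -> C) : 0 <= r ->
  summ_at r u -> summ_at r v -> summ_at r (fun n => u n + v n)%C.
Proof.
  intros Hr Hu Hv. apply ex_series_dom with (2 := ex_series_plus_R _ _ Hu Hv).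
  intros n. rewrite Rabs_pos_eq by (apply (term_ge_0 (fun n => (u n + v n)%C)); auto).
  rewrite <- Rmult_plus_distr_r. apply Rmult_le_compat_r; [apply pow_le; auto | apply Cmod_triangle].
Qed.

Lemma ev_plus (u v : nat -> C) (z : C) : summ_at (Cmod z) u -> summ_at (Cmod z) v ->
  ev (fun n => u n + v n)%C z = (ev u z + ev v z)%C.
Proof.
  intros Hu Hv. apply summ_at_terms in Hu, Hv. unfold ev.
  rewrite <- csum_plus by assumption. apply csum_ext. intros n. ring.
Qed.

Lemma summ_at_scal (r : R) (c : C) (u : nat -> C) : 0 <= r ->
  summ_at r u -> summ_at r (fun n => c * u n)%C.
Proof.
  intros Hr. apply summ_at_dom with (Cmod c); auto. intros n. rewrite Cmod_mult. lra.
Qed.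

Lemma ev_scal (c : C) (u : nat -> C) (z : C) : summ_at (Cmod z) u ->
  ev (fun n => c * u n)%C z = (c * ev u z)%C.
Proof.
  intros Hu. apply summ_at_terms in Hu. unfold ev.
  rewrite <- csum_scal by assumption. apply csum_ext. intros n. ring.
Qed.

Lemma summ_at_ps_one (r : R) : 0 <= r -> summ_at r ps_one.
Proof.
  intros Hr. apply ex_series_dom with (fun n => 0 ^ n).
  - intros [|n]; simpl; [rewrite Cmod_1, Rmult_1_r, Rabs_R1; lra|].
    rewrite Cmod_0, !Rmult_0_l, Rabs_R0. lra.
  - apply ex_series_geom. rewrite Rabs_R0; lra.
Qed.

Lemma ev_head (u : nat -> C) (z : C) : summ_at (Cmod z) u ->
  ev u z = (u 0%nat + z * ev (tl u) z)%C.
Proof.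
  intros H. unfold ev. rewrite csum_head by (apply summ_at_terms; auto).
  rewrite <- csum_scal by (apply summ_at_terms, summ_at_tail; auto; apply Cmod_ge_0).
  simpl. rewrite Cmult_1_r. f_equal. apply csum_ext. intros n. unfold tl. ring.
Qed.

Lemma csum_0 : csum (fun _ => RtoC 0) = RtoC 0.
Proof.
  assert (E : Series (fun _ : nat => 0) = 0).
  { rewrite (Series_ext _ (fun _ => 0 * 0)) by (intros; ring).
    rewrite Series_scal_l. ring. }
  unfold csum. simpl. rewrite E. reflexivity.
Qed.

Lemma ev_null (u : nat -> C) (z : C) : (forall n, u n = RtoC 0) -> ev u z = RtoC 0.
Proof.
  intros H. rewrite <- csum_0. apply csum_ext. intros n. rewrite H. apply Cmult_0_l.
Qed.

Lemma ev_ps_one (z : C) : ev ps_one z = RtoC 1.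
Proof.
  rewrite ev_head by (apply summ_at_ps_one, Cmod_ge_0). rewrite ev_null by reflexivity.
  simpl. ring.
Qed.

Lemma ev_at_0 (u : nat -> C) : ev u (RtoC 0) = u 0%nat.
Proof. rewrite ev_head; [ring|]. rewrite Cmod_0. apply summ_at_0. Qed.

Lemma Cmod_real (t : R) : 0 <= t -> Cmod (RtoC t) = t.
Proof. intros H. rewrite Cmod_R. apply Rabs_pos_eq; auto. Qed.

Lemma Cmod_scl (t : R) (u : nat -> C) (n : nat) : 0 <= t ->
  Cmod (scl t u n) = Cmod (u n) * t ^ n.
Proof. intros H. unfold scl. rewrite Cmod_mult, Cmod_pow, Cmod_real; auto. Qed.

Lemma summ_at_scl (r t : R) (u : nat -> C) : 0 <= t -> summ_at (r * t) u -> summ_at r (scl t u).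
Proof.
  intros Ht. apply ex_series_eq. intros n. rewrite Cmod_scl, Rpow_mult_distr by auto. ring.
Qed.

Lemma ev_scl (t : R) (u : nat -> C) (z : C) : ev (scl t u) z = ev u (z * RtoC t)%C.
Proof. apply csum_ext. intros n. unfold scl. rewrite Cpow_mult_l. ring. Qed.

Lemma conv_scl (t : R) (u v : nat -> C) (n : nat) :
  conv (scl t u) (scl t v) n = scl t (conv u v) n.
Proof. apply conv_scl_C. Qed.

(** The mean value inequality for the powers, in a form in which the factor
    n s^(n-1) is replaced by a difference quotient of r^n, so that summing
    over n needs only the convergence at r. *)
Lemma Cpow_diff_le (a b : C) (s r : R) (n : nat) : Cmod a <= s -> Cmod b <= s -> s < r ->
  Cmod (a ^ n - b ^ n) * (r - s) <= Cmod (a - b) * (r ^ n - s ^ n).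
Proof.
  intros Ha Hb Hr. assert (Hs : 0 <= s) by (pose proof (Cmod_ge_0 a); lra).
  induction n as [|n IH].
  - simpl. replace (1 - 1)%C with (RtoC 0) by ring. rewrite Cmod_0. lra.
  - assert (E : (a ^ S n - b ^ S n = a * (a ^ n - b ^ n) + (a - b) * b ^ n)%C) by (simpl; ring).
    rewrite E. pose proof (Cmod_triangle (a * (a ^ n - b ^ n)) ((a - b) * b ^ n)) as T.
    rewrite !Cmod_mult, Cmod_pow in T.
    assert (P0 := Cmod_ge_0 (a - b)). assert (P1 := Cmod_ge_0 (a ^ n - b ^ n)).
    assert (B : Cmod b ^ n <= s ^ n) by (apply pow_incr; split; [apply Cmod_ge_0|auto]).
    assert (M : s ^ n <= r ^ n) by (apply pow_incr; lra).
    assert (T1 : Cmod a * Cmod (a ^ n - b ^ n) <= s * Cmod (a ^ n - b ^ n))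
      by (apply Rmult_le_compat_r; auto).
    assert (T2 : Cmod (a - b) * Cmod b ^ n <= Cmod (a - b) * s ^ n)
      by (apply Rmult_le_compat_l; auto).
    apply Rle_trans with ((s * Cmod (a ^ n - b ^ n) + Cmod (a - b) * s ^ n) * (r - s)).
    { apply Rmult_le_compat_r; lra. }
    apply Rle_trans with (s * (Cmod (a - b) * (r ^ n - s ^ n)) + Cmod (a - b) * s ^ n * (r - s)).
    { assert (s * (Cmod (a ^ n - b ^ n) * (r - s)) <= s * (Cmod (a - b) * (r ^ n - s ^ n)))
        by (apply Rmult_le_compat_l; auto). lra. }
    simpl.
    assert (0 <= Cmod (a - b) * ((r - s) * (r ^ n - s ^ n))).
    { apply Rmult_le_pos; auto. apply Rmult_le_pos; lra. }
    lra.
Qed.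

Lemma ev_lipschitz (u : nat -> C) (t s : R) : analytic_in t u -> 0 <= s < t ->
  exists L, 0 < L /\ forall a b : C, Cmod a <= s -> Cmod b <= s ->
    Cmod (ev u a - ev u b) <= L * Cmod (a - b).
Proof.
  intros Hu Hs. set (r := (s + t) / 2).
  assert (Hr : summ_at r u) by (apply Hu; unfold r; lra).
  (* the Lipschitz constant of u_n z^n on the disk of radius s is at most c |u_n| r^n *)
  set (c := / (r - s)). assert (Hc : 0 < c) by (apply Rinv_0_lt_compat; unfold r; lra).
  exists (1 + c * Series (fun n => Cmod (u n) * r ^ n)).
  assert (HS : 0 <= Series (fun n => Cmod (u n) * r ^ n)).
  { apply Series_nonneg; auto. intros n. apply term_ge_0. unfold r; lra. }
  split; [pose proof (Rmult_le_pos c _ (Rlt_le _ _ Hc) HS); lra|].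
  intros a b Ha Hb. pose proof (Cmod_ge_0 a). pose proof (Cmod_ge_0 b).
  assert (Sa : abs_summable (fun n => u n * a ^ n)%C) by (apply summ_at_terms, Hu; lra).
  assert (Sb : abs_summable (fun n => u n * b ^ n)%C) by (apply summ_at_terms, Hu; lra).
  assert (Sd : ex_series (fun n => Cmod (a - b) * c * (Cmod (u n) * r ^ n))).
  { apply ex_series_scal_R, Hr. }
  assert (Hd : forall n, Cmod (u n * a ^ n + - (1) * (u n * b ^ n))%C
                <= Cmod (a - b) * c * (Cmod (u n) * r ^ n)).
  { intros n. replace (u n * a ^ n + - (1) * (u n * b ^ n))%C with (u n * (a ^ n - b ^ n))%C by ring.
    rewrite Cmod_mult. pose proof (Cpow_diff_le a b s r n Ha Hb ltac:(unfold r; lra)) as D.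
    assert (Hrs : 0 < r - s) by (unfold r; lra).
    assert (D2 : Cmod (a ^ n - b ^ n) <= Cmod (a - b) * c * r ^ n).
    { apply Rmult_le_reg_r with (r - s); auto. unfold c.
      replace (Cmod (a - b) * / (r - s) * r ^ n * (r - s)) with (Cmod (a - b) * r ^ n) by (field; lra).
      eapply Rle_trans; [exact D|]. apply Rmult_le_compat_l; [apply Cmod_ge_0|].
      assert (0 <= s ^ n) by (apply pow_le; lra). lra. }
    replace (Cmod (a - b) * c * (Cmod (u n) * r ^ n)) with (Cmod (u n) * (Cmod (a - b) * c * r ^ n)) by ring.
    apply Rmult_le_compat_l; auto. apply Cmod_ge_0. }
  assert (E : (ev u a - ev u b)%C = csum (fun n => u n * a ^ n + - (1) * (u n * b ^ n))%C).
  { rewrite (csum_plus _ (fun n => - (1) * (u n * b ^ n))%C); auto.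
    - rewrite csum_scal by auto. unfold ev. ring.
    - apply abs_summable_dom with (2 := Sb). intros n. rewrite Cmod_mult, Cmod_m1. lra. }
  rewrite E. eapply Rle_trans; [apply Cmod_csum_le|].
  { apply abs_summable_dom with (2 := Sd). apply Hd. }
  apply Rle_trans with (Series (fun n => Cmod (a - b) * c * (Cmod (u n) * r ^ n))).
  { apply Series_le; auto. intros n. split; [apply Cmod_ge_0 | apply Hd]. }
  rewrite Series_scal_l. pose proof (Cmod_ge_0 (a - b)). lra.
Qed.

(** * Cauchy's estimate *)

Definition cis (x : R) : C := (cos x, sin x).

Lemma cis_plus (x y : R) : (cis x * cis y)%C = cis (x + y).
Proof. unfold cis. apply C_ext; simpl; rewrite ?cos_plus, ?sin_plus; ring. Qed.

Lemma cis_pow (x : R) (n : nat) : (cis x ^ n)%C = cis (INR n * x).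
Proof.
  induction n as [|n IH].
  - simpl. rewrite Rmult_0_l. unfold cis. rewrite cos_0, sin_0. reflexivity.
  - change (cis x ^ S n)%C with (cis x * cis x ^ n)%C. rewrite IH, cis_plus.
    rewrite S_INR. f_equal. ring.
Qed.

Lemma Cmod_cis (x : R) : Cmod (cis x) = 1.
Proof.
  unfold Cmod, cis. simpl fst; simpl snd.
  replace (cos x ^ 2 + sin x ^ 2) with 1; [apply sqrt_1|].
  pose proof (sin2_cos2 x). unfold Rsqr in *. lra.
Qed.

Lemma cis_2kPI (n : nat) : cis (2 * INR n * PI) = RtoC 1.
Proof.
  pose proof (cos_period 0 n) as H1. pose proof (sin_period 0 n) as H2.
  rewrite Rplus_0_l in H1, H2. unfold cis. rewrite H1, H2, cos_0, sin_0. reflexivity.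
Qed.

Lemma cis_opp_2kPI (n : nat) : cis (- (2 * INR n * PI)) = RtoC 1.
Proof.
  pose proof (cis_2kPI n) as H. unfold cis in *. rewrite cos_neg, sin_neg.
  injection H. intros H1 H2. rewrite H1, H2. apply C_ext; simpl; lra.
Qed.

Lemma cis_neq_1 (x : R) : 0 < Rabs x < 2 * PI -> cis x <> RtoC 1.
Proof.
  intros Hx E. injection E. intros _ Ec.
  assert (Ec' : cos (Rabs x) = 1).
  { unfold Rabs. destruct (Rcase_abs x); rewrite ?cos_neg; auto. }
  set (y := Rabs x) in *.
  replace y with (2 * (y / 2)) in Ec' by field.
  rewrite cos_2a_sin in Ec'.
  assert (0 < sin (y / 2)) by (apply sin_gt_0; lra).
  assert (0 < sin (y / 2) * sin (y / 2)) by (apply Rmult_lt_0_compat; auto). lra.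
Qed.

Fixpoint fsum (f : nat -> C) (N : nat) : C :=
  match N with O => RtoC 0 | S n => (fsum f n + f n)%C end.

Lemma fsum_ext (f g : nat -> C) (N : nat) :
  (forall j, (j < N)%nat -> f j = g j) -> fsum f N = fsum g N.
Proof.
  induction N as [|N IH]; intros H; simpl; auto.
  rewrite IH by (intros; apply H; lia). rewrite H by lia. reflexivity.
Qed.

Lemma fsum_plus (f g : nat -> C) (N : nat) :
  fsum (fun j => f j + g j)%C N = (fsum f N + fsum g N)%C.
Proof. induction N as [|N IH]; simpl; [|rewrite IH]; ring. Qed.

Lemma fsum_scal (c : C) (f : nat -> C) (N : nat) :
  fsum (fun j => c * f j)%C N = (c * fsum f N)%C.
Proof. induction N as [|N IH]; simpl; [|rewrite IH]; ring. Qed.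

Lemma fsum_swap (f : nat -> nat -> C) (N M : nat) :
  fsum (fun j => fsum (fun k => f j k) M) N = fsum (fun k => fsum (fun j => f j k) N) M.
Proof.
  induction N as [|N IH]; simpl.
  - induction M as [|M IHM]; simpl; auto. rewrite <- IHM. ring.
  - rewrite IH, <- fsum_plus. reflexivity.
Qed.

Lemma Cmod_fsum_le (f : nat -> C) (B : R) (N : nat) :
  (forall j, (j < N)%nat -> Cmod (f j) <= B) -> Cmod (fsum f N) <= INR N * B.
Proof.
  induction N as [|N IH]; intros H.
  - simpl. rewrite Cmod_0. lra.
  - rewrite S_INR. simpl fsum. eapply Rle_trans; [apply Cmod_triangle|].
    specialize (IH ltac:(intros; apply H; lia)). specialize (H N ltac:(lia)). lra.
Qed.

Lemma fsum_geom (q : C) (N : nat) : (fsum (fun j => q ^ j) N * (q - 1) = q ^ N - 1)%C.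
Proof. induction N as [|N IH]; simpl; [ring|]. rewrite Cmult_plus_distr_r, IH. ring. Qed.

Lemma fsum_single (c : nat -> C) (n N : nat) : (n < N)%nat ->
  (forall k, (k < N)%nat -> k <> n -> c k = RtoC 0) -> fsum c N = c n.
Proof.
  induction N as [|N IH]; intros Hn H; [lia|]. simpl.
  destruct (Nat.eq_dec n N) as [->|Hne].
  - assert (Z : forall M, (M <= N)%nat -> fsum c M = RtoC 0).
    { induction M as [|M IHM]; intros HM; simpl; auto.
      rewrite IHM, (H M) by lia. ring. }
    rewrite Z by lia. ring.
  - rewrite IH by (try lia; intros; apply H; lia). rewrite (H N) by lia. ring.
Qed.

(** Orthogonality of the characters of the cyclic group of order [N]. *)
Lemma root_of_unity_sum (N k n : nat) : (k < N)%nat -> (n < N)%nat ->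
  fsum (fun j => cis (2 * PI * INR j / INR N) ^ k * cis (- (2 * PI * INR j / INR N)) ^ n)%C N
  = if Nat.eq_dec k n then RtoC (INR N) else RtoC 0.
Proof.
  intros Hk Hn. assert (HN : 0 < INR N) by (apply lt_0_INR; lia).
  set (x := 2 * PI * (INR k - INR n) / INR N).
  rewrite (fsum_ext _ (fun j => cis x ^ j)%C).
  2: { intros j _. rewrite !cis_pow, cis_plus. f_equal. unfold x. field. lra. }
  destruct (Nat.eq_dec k n) as [->|Hne].
  - assert (E : cis x = RtoC 1).
    { unfold x. replace (2 * PI * (INR n - INR n) / INR N) with 0 by (field; lra).
      unfold cis. rewrite cos_0, sin_0. reflexivity. }
    rewrite E. clear. induction N as [|N IH]; [reflexivity|].
    simpl fsum. rewrite IH, Cpow_1_l, S_INR, RtoC_plus. reflexivity.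
  - assert (HPI := PI_RGT_0).
    assert (Hq : cis x <> RtoC 1).
    { apply cis_neq_1. unfold x.
      replace (2 * PI * (INR k - INR n) / INR N) with (2 * PI * ((INR k - INR n) / INR N)) by (field; lra).
      rewrite Rabs_mult, (Rabs_pos_eq (2 * PI)) by lra.
      unfold Rdiv. rewrite Rabs_mult, (Rabs_pos_eq (/ INR N)) by (left; apply Rinv_0_lt_compat; auto).
      assert (A1 : 0 < Rabs (INR k - INR n)).
      { apply Rabs_pos_lt. intros E. apply Hne. apply INR_eq. lra. }
      assert (A2 : Rabs (INR k - INR n) < INR N).
      { apply lt_INR in Hk, Hn. pose proof (pos_INR k). pose proof (pos_INR n).
        apply Rabs_def1; lra. }
      assert (A3 : 0 < Rabs (INR k - INR n) * / INR N).
      { apply Rmult_lt_0_compat; auto. apply Rinv_0_lt_compat; auto. }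
      assert (A4 : Rabs (INR k - INR n) * / INR N < 1).
      { apply Rmult_lt_reg_r with (INR N); auto. rewrite Rmult_assoc, Rinv_l; lra. }
      split; [apply Rmult_lt_0_compat; lra|].
      apply Rlt_le_trans with (2 * PI * 1); [apply Rmult_lt_compat_l|]; lra. }
    assert (Hp : (cis x ^ N)%C = RtoC 1).
    { rewrite cis_pow. destruct (Nat.le_ge_cases n k) as [L|L].
      - replace (INR N * x) with (2 * INR (k - n) * PI); [apply cis_2kPI|].
        unfold x. rewrite minus_INR by auto. field. lra.
      - replace (INR N * x) with (- (2 * INR (n - k) * PI)); [apply cis_opp_2kPI|].
        unfold x. rewrite minus_INR by auto. field. lra. }
    pose proof (fsum_geom (cis x) N) as G. rewrite Hp in G.
    assert (Hq' : (cis x - 1)%C <> RtoC 0).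
    { intros E. apply Hq. replace (cis x) with (cis x - 1 + 1)%C by ring. rewrite E. ring. }
    set (S0 := fsum _ N) in *.
    replace S0 with (S0 * (cis x - 1) / (cis x - 1))%C by (field; auto).
    rewrite G. field. auto.
Qed.

Lemma csum_split (a : nat -> C) (N : nat) : abs_summable a ->
  csum a = (fsum a N + csum (fun k => a (N + k)%nat))%C
  /\ abs_summable (fun k => a (N + k)%nat).
Proof.
  intros Ha. induction N as [|N [E IH]]; simpl.
  - split; [symmetry; apply Cplus_0_l | exact Ha].
  - split.
    + rewrite E, csum_head by auto. rewrite Nat.add_0_r.
      rewrite (csum_ext (fun n => a (N + S n)%nat) (fun k => a (S (N + k)))).
      * ring.
      * intros n. f_equal. lia.
    + apply ex_series_eq with (fun n => Cmod (a (N + S n)%nat)).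
      * intros n. do 2 f_equal. lia.
      * apply (ex_series_incr_1 (fun n => Cmod (a (N + n)%nat))). exact IH.
Qed.

Lemma Series_tail_small (a : nat -> R) (eps : R) : ex_series a -> 0 < eps ->
  exists N0, forall N, (N0 <= N)%nat -> Series (fun k => a (N + k)%nat) < eps.
Proof.
  intros Ha He. pose proof (Series_correct _ Ha) as H.
  assert (K := proj1 (filterlim_locally _ _) H (mkposreal eps He)).
  destruct K as [N0 HN0]. exists (S N0). intros N HN.
  specialize (HN0 (pred N) ltac:(lia)).
  rewrite (Series_incr_n a N) in HN0 by (auto; lia).
  rewrite sum_n_Reals in HN0.
  change (Rabs (sum_f_R0 a (pred N) - (sum_f_R0 a (pred N) + Series (fun k => a (N + k)%nat))) < eps) in HN0.
  apply Rabs_def2 in HN0. lra.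
Qed.

(** Averaging u(z) z^(-n) over N equidistant points of the circle isolates the
    coefficient of degree n of the Taylor polynomial of degree N - 1, and the
    remainder of the series is uniformly small for N large. This discrete
    average stands for Cauchy's integral. *)
Lemma cauchy_estimate_at (u : nat -> C) (r B : R) (n : nat) : 0 <= r -> summ_at r u ->
  (forall z, Cmod z = r -> Cmod (ev u z) <= B) -> Cmod (u n) * r ^ n <= B.
Proof.
  intros Hr Hu HB. apply Rnot_lt_le. intros Hlt.
  set (eps := Cmod (u n) * r ^ n - B) in *.
  destruct (Series_tail_small _ eps Hu) as [N0 HN0]; [unfold eps; lra|].
  set (N := (N0 + S n)%nat). specialize (HN0 N ltac:(lia)).
  set (T := Series (fun k => Cmod (u (N + k)%nat) * r ^ (N + k))) in *.
  assert (HN : 0 < INR N) by (apply lt_0_INR; lia).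
  set (w := fun j : nat => cis (2 * PI * INR j / INR N)).
  set (w' := fun j : nat => cis (- (2 * PI * INR j / INR N))).
  set (z := fun j : nat => (RtoC r * w j)%C).
  assert (Hz : forall j, Cmod (z j) = r).
  { intros j. unfold z, w. rewrite Cmod_mult, Cmod_cis, Cmod_real; auto. ring. }
  set (P := fun j => fsum (fun k => u k * z j ^ k)%C N).
  assert (HP : forall j, Cmod (P j) <= B + T).
  { intros j.
    assert (Hs : abs_summable (fun k => u k * z j ^ k)%C).
    { apply summ_at_terms. rewrite Hz. exact Hu. }
    destruct (csum_split _ N Hs) as [E Ht].
    replace (P j) with (ev u (z j) + - (1) * csum (fun k => u (N + k)%nat * z j ^ (N + k)))%C.
    2: { unfold ev. rewrite E. unfold P. ring. }
    eapply Rle_trans; [apply Cmod_triangle|].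
    rewrite Cmod_mult, Cmod_m1, Rmult_1_l.
    apply Rplus_le_compat; [apply HB, Hz|].
    eapply Rle_trans; [apply Cmod_csum_le; exact Ht|].
    right. apply Series_ext. intros k. rewrite Cmod_mult, Cmod_pow, Hz. reflexivity. }
  assert (HA : (fsum (fun j => P j * w' j ^ n) N = RtoC (INR N) * (u n * RtoC r ^ n))%C).
  { rewrite (fsum_ext _ (fun j => fsum (fun k => (u k * RtoC r ^ k) * (w j ^ k * w' j ^ n)) N)%C).
    2: { intros j _. unfold P. rewrite Cmult_comm, <- fsum_scal. apply fsum_ext.
         intros k _. unfold z. rewrite Cpow_mult_l. ring. }
    rewrite fsum_swap.
    rewrite (fsum_ext _ (fun k => (u k * RtoC r ^ k) * (if Nat.eq_dec k n then RtoC (INR N) else RtoC 0))%C).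
    2: { intros k Hk. rewrite fsum_scal. f_equal. apply root_of_unity_sum; lia. }
    rewrite (fsum_single _ n).
    - destruct (Nat.eq_dec n n); [ring|congruence].
    - lia.
    - intros k _ Hk. destruct (Nat.eq_dec k n); [congruence|ring]. }
  assert (HC : Cmod (fsum (fun j => P j * w' j ^ n)%C N) <= INR N * (B + T)).
  { apply Cmod_fsum_le. intros j _. rewrite Cmod_mult, Cmod_pow. unfold w'.
    rewrite Cmod_cis, pow1, Rmult_1_r. apply HP. }
  rewrite HA, !Cmod_mult, Cmod_pow, !Cmod_real in HC by lra.
  apply Rmult_le_reg_l in HC; auto. unfold eps in HN0. lra.
Qed.

(** Lets a radius tend to the boundary in an estimate of a coefficient. *)
Lemma pow_limit (c t B : R) (n : nat) : 0 <= c -> 0 < t ->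
  (forall r, 0 <= r < t -> c * r ^ n <= B) -> c * t ^ n <= B.
Proof.
  intros Hc Ht H.
  assert (Hcont : continuity_pt (fun r => c * r ^ n) t) by (apply derivable_continuous_pt; reg).
  apply Rnot_lt_le. intros Hlt.
  destruct (Hcont (c * t ^ n - B)) as [d [Hd K]]; [lra|].
  set (r := Rmax (t / 2) (t - d / 2)).
  assert (Hr : t / 2 <= r < t /\ t - d / 2 <= r).
  { unfold r. repeat split; [apply Rmax_l | apply Rmax_lub_lt; lra | apply Rmax_r]. }
  specialize (H r ltac:(lra)).
  assert (Kr : Rabs (c * r ^ n - c * t ^ n) < c * t ^ n - B).
  { apply (K r). split; [split; [exact I|lra]|]. simpl. unfold R_dist.
    apply Rabs_def1; lra. }
  apply Rabs_def2 in Kr. lra.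
Qed.

Lemma cauchy_estimate (u : nat -> C) (t B : R) (n : nat) : 0 < t -> analytic_in t u ->
  (forall z, Cmod z < t -> Cmod (ev u z) <= B) -> Cmod (u n) * t ^ n <= B.
Proof.
  intros Ht Hu HB. apply pow_limit; auto; [apply Cmod_ge_0|].
  intros r Hr. apply cauchy_estimate_at; [lra|apply Hu; auto|].
  intros z Hz. apply HB. lra.
Qed.

(** * The reciprocal of a zero-free series *)

Lemma conv_ext_le (a b b' : nat -> C) (n : nat) :
  (forall k, (k <= n)%nat -> b k = b' k) -> conv a b n = conv a b' n.
Proof.
  revert a. induction n as [|n IH]; intros a H; simpl.
  - rewrite H by lia. reflexivity.
  - rewrite (H (S n)) by lia. rewrite (IH (tl a)); [reflexivity|]. intros; apply H; lia.
Qed.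

(** The coefficient of degree p + 1 of the reciprocal depends on all the
    previous ones, so the recursion carries a function that is correct up to
    the current degree. *)
Fixpoint inv_prefix (G : nat -> C) (n : nat) : nat -> C :=
  match n with
  | O => fun _ => (/ G O)%C
  | S p => fun k => if Nat.leb k p then inv_prefix G p k
                    else (- (conv (tl G) (inv_prefix G p) p / G O))%C
  end.

(** The equation determines the coefficients of [v] one after the other, its
    coefficient [n] being linear in [v n] with factor [G O]. *)
Lemma ps_inverse_exists (G : nat -> C) : G O <> RtoC 0 ->
  exists v, forall n, conv v G n = ps_one n.
Proof.
  intros HG. exists (fun n => inv_prefix G n n).
  set (v := fun n => inv_prefix G n n).
  assert (Hv : forall n k, (k <= n)%nat -> inv_prefix G n k = v k).
  { induction n as [|n IH]; intros k Hk.
    - replace k with 0%nat by lia. reflexivity.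
    - destruct (Nat.eq_dec k (S n)) as [->|Hne]; [reflexivity|].
      simpl. assert (E : Nat.leb k n = true) by (apply Nat.leb_le; lia).
      rewrite E. apply IH; lia. }
  intros n. rewrite conv_comm. destruct n as [|n].
  - simpl. unfold v. simpl. field. auto.
  - assert (E : v (S n) = (- (conv (tl G) v n / G O))%C).
    { unfold v at 1. cbn [inv_prefix]. assert (E : Nat.leb (S n) n = false) by (apply Nat.leb_gt; lia).
      rewrite E. do 2 f_equal. apply conv_ext_le. apply Hv. }
    simpl. rewrite E. field. auto.
Qed.

(** Coefficient n of a product is a finite sum, hence it tends to 0 with the
    coefficients of the second factor. *)
Lemma conv_small (n : nat) (a : nat -> C) : exists A, 0 <= A /\
  forall b e, (forall k, Cmod (b k) <= e) -> Cmod (conv a b n) <= A * e.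
Proof.
  revert a. induction n as [|n IH]; intros a.
  - exists (Cmod (a O)). split; [apply Cmod_ge_0|]. intros b e H. simpl.
    rewrite Cmod_mult. apply Rmult_le_compat_l; [apply Cmod_ge_0 | apply H].
  - destruct (IH (tl a)) as [A [HA K]]. exists (Cmod (a O) + A).
    pose proof (Cmod_ge_0 (a O)). split; [lra|]. intros b e H'. simpl.
    eapply Rle_trans; [apply Cmod_triangle|]. rewrite Cmod_mult, Rmult_plus_distr_r.
    apply Rplus_le_compat; [apply Rmult_le_compat_l; auto | apply K; auto].
Qed.

Fixpoint neg_pow (x : nat -> C) (K : nat) : nat -> C :=
  match K with
  | O => ps_one
  | S p => conv (neg_pow x p) (fun n => - (1) * x n)%C
  end.

(** The partial sums of the geometric series of -x. *)
Fixpoint neumann (x : nat -> C) (K : nat) : nat -> C :=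
  match K with
  | O => fun _ => RtoC 0
  | S p => fun n => (neumann x p n + neg_pow x p n)%C
  end.

Lemma summ_at_zero (r : R) : 0 <= r -> summ_at r (fun _ => RtoC 0).
Proof.
  intros Hr. apply summ_at_dom with (v := ps_one) (K := 0) (r' := r); auto.
  - intros n. rewrite Cmod_0. lra.
  - apply summ_at_ps_one; auto.
Qed.

(** The partial sums of the geometric series of -x are bounded by 2 on the
    disk, hence so are their coefficients by Cauchy's estimate. The formal
    reciprocal y of 1 + x differs from them by y (-x)^K, whose coefficient n
    tends to 0 with K because the coefficients of (-x)^K are at most 2^(-K).
    Thus y is analytic in the disk, which is not known beforehand. *)
Lemma neumann_bound (x y : nat -> C) : analytic_in 1 x ->
  (forall z, Cmod z < 1 -> Cmod (ev x z) <= 1 / 2) ->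
  (forall n, conv y (fun k => ps_one k + x k)%C n = ps_one n) ->
  forall n, Cmod (y n) <= 2.
Proof.
  intros Hx Bx Hy.
  set (mx := fun k => (- (1) * x k)%C).
  assert (Amx : analytic_in 1 mx).
  { intros r Hr. apply (summ_at_scal r (- (1))%C); [lra | apply Hx; auto]. }
  assert (Aq : forall K, analytic_in 1 (neg_pow x K)).
  { induction K as [|K IH]; intros r Hr; simpl.
    - apply summ_at_ps_one; lra.
    - apply summ_at_conv; [lra | apply IH; auto | apply Amx; auto]. }
  assert (Bq : forall K z, Cmod z < 1 -> Cmod (ev (neg_pow x K) z) <= (1 / 2) ^ K).
  { induction K as [|K IH]; intros z Hz; simpl; assert (Hz0 := Cmod_ge_0 z).
    - rewrite ev_ps_one, Cmod_1. lra.
    - rewrite ev_conv by (try apply Aq; try apply Amx; lra).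
      rewrite ev_scal by (apply Hx; lra). rewrite !Cmod_mult, Cmod_m1, Rmult_1_l, Rmult_comm.
      apply Rmult_le_compat; auto using Cmod_ge_0. }
  assert (Ap : forall K, analytic_in 1 (neumann x K)).
  { induction K as [|K IH]; intros r Hr; simpl.
    - apply summ_at_zero; lra.
    - apply summ_at_plus; [lra | apply IH; auto | apply Aq; auto]. }
  assert (Bp : forall K z, Cmod z < 1 -> Cmod (ev (neumann x K) z) <= 2 - 2 * (1 / 2) ^ K).
  { induction K as [|K IH]; intros z Hz; simpl; assert (Hz0 := Cmod_ge_0 z).
    - rewrite ev_null by reflexivity. rewrite Cmod_0. lra.
    - rewrite ev_plus by (try apply Aq; try apply Ap; lra).
      eapply Rle_trans; [apply Cmod_triangle|].
      specialize (IH z Hz). specialize (Bq K z Hz). lra. }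
  assert (Cq : forall K n, Cmod (neg_pow x K n) <= (1 / 2) ^ K).
  { intros K n. pose proof (cauchy_estimate (neg_pow x K) 1 _ n Rlt_0_1 (Aq K) (Bq K)) as E.
    rewrite pow1, Rmult_1_r in E. exact E. }
  assert (Cp : forall K n, Cmod (neumann x K n) <= 2).
  { intros K n. pose proof (cauchy_estimate (neumann x K) 1 _ n Rlt_0_1 (Ap K) (Bp K)) as E.
    rewrite pow1, Rmult_1_r in E. assert (0 < (1 / 2) ^ K) by (apply pow_lt; lra). lra. }
  (* y = 1 - y x, hence y q_K = q_K + y q_(K+1) *)
  assert (Y : forall n, y n = (ps_one n + conv y mx n)%C).
  { intros n. rewrite <- (Hy n), conv_plus_r, conv_ps_one_r. unfold mx. rewrite conv_scal_r. ring. }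
  assert (E : forall K n, y n = (neumann x K n + conv y (neg_pow x K) n)%C).
  { induction K as [|K IH]; intros n.
    - simpl. rewrite conv_ps_one_r. ring.
    - rewrite IH. simpl. fold mx.
      rewrite (conv_ext y (fun n => ps_one n + conv y mx n)%C _ (neg_pow x K)) by auto.
      rewrite conv_plus_l, conv_ps_one_l, conv_assoc.
      rewrite (conv_ext y y (conv mx (neg_pow x K)) (conv (neg_pow x K) mx)).
      + ring.
      + reflexivity.
      + intros k. apply conv_comm. }
  intros n. destruct (conv_small n y) as [A [HA KA]].
  apply Rnot_lt_le. intros Hlt.
  destruct (pow_lt_1_zero (1 / 2) ltac:(rewrite Rabs_pos_eq; lra) ((Cmod (y n) - 2) / (A + 1))) as [K HK].
  { apply Rdiv_lt_0_compat; lra. }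
  specialize (HK K ltac:(lia)).
  assert (Hpos : 0 < (1 / 2) ^ K) by (apply pow_lt; lra).
  rewrite Rabs_pos_eq in HK by lra.
  specialize (KA _ _ (Cq K)).
  assert (H1 : Cmod (y n) <= 2 + A * (1 / 2) ^ K).
  { rewrite (E K n) at 1. eapply Rle_trans; [apply Cmod_triangle|].
    specialize (Cp K n). lra. }
  assert (H2 : (1 / 2) ^ K * (A + 1) < Cmod (y n) - 2).
  { apply Rmult_lt_reg_r with (/ (A + 1)); [apply Rinv_0_lt_compat; lra|].
    rewrite Rmult_assoc, Rinv_r by lra. unfold Rdiv in HK. lra. }
  lra.
Qed.

Lemma scl_ps_one (t : R) (n : nat) : scl t ps_one n = ps_one n.
Proof. unfold scl. destruct n; simpl; ring. Qed.

(** One step of the continuation of the reciprocal v of G from radius t to the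
    slightly larger radius t'. With x(z) = v(tz) (G(t'z) - G(tz)) one has
    G(t'z) = G(tz) (1 + x(z)), and |x| <= 1/2 because |v| <= 1/kappa at radius
    t and G is Lipschitz. So 1 + x has an analytic reciprocal y, and
    v(t'z) = v(tz) y(z) is analytic. As soon as it is, |G| >= kappa bounds it
    by 1/kappa: the bound does not deteriorate from one step to the next. *)
Lemma inverse_step (G v : nat -> C) (tau sigma kappa L t t' : R) :
  analytic_in tau G -> sigma < tau -> 0 < kappa ->
  (forall z, Cmod z <= sigma -> kappa <= Cmod (ev G z)) ->
  (forall n, conv v G n = ps_one n) ->
  (forall a b, Cmod a <= sigma -> Cmod b <= sigma -> Cmod (ev G a - ev G b) <= L * Cmod (a - b)) ->
  0 < L -> 0 <= t <= t' -> t' <= sigma -> (t' - t) * (2 * L) <= kappa ->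
  (forall n, Cmod (v n) * t ^ n <= / kappa) -> forall n, Cmod (v n) * t' ^ n <= / kappa.
Proof.
  intros HG Hst Hk Hmin Hv HL HL0 Ht Ht' Hstep Hbd.
  assert (AG : forall s, 0 <= s <= sigma -> analytic_in 1 (scl s G)).
  { intros s Hs r Hr. apply summ_at_scl; [lra|]. apply HG.
    assert (r * s <= 1 * s) by (apply Rmult_le_compat_r; lra).
    split; [apply Rmult_le_pos; lra | lra]. }
  assert (Inv : forall s n, conv (scl s v) (scl s G) n = ps_one n).
  { intros s n. rewrite conv_scl. rewrite <- (scl_ps_one s). unfold scl. rewrite Hv. reflexivity. }
  assert (Hzs : forall s z, 0 <= s <= sigma -> Cmod z < 1 -> Cmod (z * RtoC s) <= sigma).
  { intros s z Hs Hz. rewrite Cmod_mult, Cmod_real by lra.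
    assert (Cmod z * s <= 1 * s) by (apply Rmult_le_compat_r; lra). lra. }
  assert (Bv : forall s, 0 <= s <= sigma -> analytic_in 1 (scl s v) ->
             forall z, Cmod z < 1 -> Cmod (ev (scl s v) z) <= / kappa).
  { intros s Hs Av z Hz. assert (Hz0 := Cmod_ge_0 z).
    assert (E : (ev (scl s v) z * ev (scl s G) z)%C = RtoC 1).
    { rewrite <- ev_conv by (try apply Av; try apply AG; lra).
      rewrite (ev_ext _ ps_one) by apply Inv. apply ev_ps_one. }
    apply (f_equal Cmod) in E. rewrite Cmod_mult, Cmod_1, (ev_scl s G) in E.
    pose proof (Hmin _ (Hzs s z Hs Hz)) as M.
    apply Rmult_le_reg_r with kappa; auto. rewrite Rinv_l by lra.
    rewrite <- E. apply Rmult_le_compat_l; auto. apply Cmod_ge_0. }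
  assert (Av : analytic_in 1 (scl t v)).
  { apply analytic_in_bounded with (/ kappa); [lra|]. intros n.
    rewrite pow1, Rmult_1_r, Cmod_scl by lra. apply Hbd. }
  set (d := fun n => (scl t' G n + - (1) * scl t G n)%C).
  set (x := conv (scl t v) d).
  assert (Ad : analytic_in 1 d).
  { intros r Hr. apply summ_at_plus; [lra | apply AG; lra |].
    apply (summ_at_scal r (- (1))%C); [lra|apply AG; lra]. }
  assert (Ax : analytic_in 1 x).
  { intros r Hr. apply summ_at_conv; [lra | apply Av; auto | apply Ad; auto]. }
  assert (Bx : forall z, Cmod z < 1 -> Cmod (ev x z) <= 1 / 2).
  { intros z Hz. assert (Hz0 := Cmod_ge_0 z). unfold x.
    rewrite ev_conv by (try apply Av; try apply Ad; lra). unfold d.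
    assert (S1 : summ_at (Cmod z) (scl t' G)) by (apply AG; lra).
    assert (S2 : summ_at (Cmod z) (scl t G)) by (apply AG; lra).
    rewrite (ev_plus _ (fun n => - (1) * scl t G n)%C); auto.
    2: { apply summ_at_scal; auto. }
    rewrite ev_scal, !(ev_scl _ G), Cmod_mult by auto.
    replace (ev G (z * RtoC t') + - (1) * ev G (z * RtoC t))%C
      with (ev G (z * RtoC t') - ev G (z * RtoC t))%C by ring.
    pose proof (HL _ _ (Hzs t' z ltac:(lra) Hz) (Hzs t z ltac:(lra) Hz)) as D.
    replace (z * RtoC t' - z * RtoC t)%C with (z * RtoC (t' - t))%C in D
      by (rewrite RtoC_minus; ring).
    rewrite Cmod_mult, Cmod_real in D by lra.
    assert (D1 : Cmod z * (t' - t) <= 1 * (t' - t)) by (apply Rmult_le_compat_r; lra).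
    assert (D2 : L * (Cmod z * (t' - t)) <= L * (t' - t)) by (apply Rmult_le_compat_l; lra).
    pose proof (Bv t ltac:(lra) Av z Hz) as D3.
    apply Rle_trans with (/ kappa * (kappa / 2)).
    - apply Rmult_le_compat; auto using Cmod_ge_0. lra.
    - right. field. lra. }
  set (y := conv (scl t' v) (scl t G)).
  (* G(t'z) = G(tz) (1 + x(z)), since v(tz) G(tz) = 1 *)
  assert (GE : forall n, conv (scl t G) (fun k => ps_one k + x k)%C n = scl t' G n).
  { intros n. rewrite conv_plus_r, conv_ps_one_r. unfold x.
    rewrite <- conv_assoc.
    rewrite (conv_ext (conv (scl t G) (scl t v)) ps_one d d).
    - rewrite conv_ps_one_l. unfold d. ring.
    - intros k. rewrite conv_comm. apply Inv.
    - reflexivity. }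
  assert (Hy : forall n, conv y (fun k => ps_one k + x k)%C n = ps_one n).
  { intros n. unfold y. rewrite conv_assoc.
    rewrite (conv_ext (scl t' v) (scl t' v) _ (scl t' G)) by auto. apply Inv. }
  pose proof (neumann_bound x y Ax Bx Hy) as By.
  assert (Ay : analytic_in 1 y).
  { apply analytic_in_bounded with 2; [lra|]. intros n. rewrite pow1, Rmult_1_r. apply By. }
  assert (Av' : analytic_in 1 (scl t' v)).
  { intros r Hr. apply summ_at_ext with (conv y (scl t v)).
    - intros n. unfold y. rewrite conv_assoc.
      rewrite (conv_ext (scl t' v) (scl t' v) (conv (scl t G) (scl t v)) ps_one).
      + apply conv_ps_one_r.
      + reflexivity.
      + intros k. rewrite conv_comm. apply Inv.
    - apply summ_at_conv; [lra | apply Ay; auto | apply Av; auto]. }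
  intros n.
  pose proof (cauchy_estimate (scl t' v) 1 _ n Rlt_0_1 Av' (Bv t' ltac:(lra) Av')) as E.
  rewrite pow1, Rmult_1_r, Cmod_scl in E by lra. exact E.
Qed.

(** The steps of [inverse_step] have a fixed length kappa / 2L and start from
    radius 0, so finitely many of them reach sigma. *)
Lemma inverse_of_zero_free (G v : nat -> C) (tau sigma kappa : R) :
  analytic_in tau G -> 0 < sigma < tau -> 0 < kappa ->
  (forall z, Cmod z <= sigma -> kappa <= Cmod (ev G z)) ->
  (forall n, conv v G n = ps_one n) ->
  analytic_in sigma v.
Proof.
  intros HG Hs Hk Hmin Hv.
  destruct (ev_lipschitz G tau sigma HG ltac:(lra)) as [L [HL0 HL]].
  (* the longest step for which the x of the continuation is at most 1/2 *)
  set (eta := kappa / (2 * L)).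
  assert (Heta : 0 < eta) by (apply Rdiv_lt_0_compat; lra).
  assert (P : forall k n, Cmod (v n) * (Rmin sigma (INR k * eta)) ^ n <= / kappa).
  { induction k as [|k IH]; intros n.
    - rewrite Rmult_0_l, Rmin_right by lra.
      assert (E : Cmod (v 0%nat) <= / kappa).
      { pose proof (Hv 0%nat) as E. simpl in E. apply (f_equal Cmod) in E.
        rewrite Cmod_mult, Cmod_1 in E.
        pose proof (Hmin (RtoC 0) ltac:(rewrite Cmod_0; lra)) as M.
        rewrite ev_at_0 in M.
        apply Rmult_le_reg_r with kappa; auto. rewrite Rinv_l, <- E by lra.
        apply Rmult_le_compat_l; auto. apply Cmod_ge_0. }
      destruct n; simpl; [lra|]. rewrite Rmult_0_l, Rmult_0_r. left. apply Rinv_0_lt_compat; auto.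
    - assert (Hk0 : 0 <= INR k * eta) by (apply Rmult_le_pos; [apply pos_INR|lra]).
      rewrite S_INR.
      assert (He : eta * (2 * L) = kappa) by (unfold eta; field; lra).
      apply (inverse_step G v tau sigma kappa L (Rmin sigma (INR k * eta))); auto; try lra.
      + unfold Rmin. destruct (Rle_dec sigma (INR k * eta)), (Rle_dec sigma ((INR k + 1) * eta)); lra.
      + apply Rmin_l.
      + rewrite <- He. apply Rmult_le_compat_r; [lra|].
        unfold Rmin. destruct (Rle_dec sigma (INR k * eta)), (Rle_dec sigma ((INR k + 1) * eta)); lra. }
  destruct (INR_unbounded (sigma / eta)) as [k Hkk].
  assert (E : Rmin sigma (INR k * eta) = sigma).
  { apply Rmin_left. apply Rmult_lt_compat_r with (r := eta) in Hkk; auto.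
    unfold Rdiv in Hkk. rewrite Rmult_assoc, Rinv_l in Hkk by lra. lra. }
  apply analytic_in_bounded with (/ kappa); [lra|].
  intros n. rewrite <- E. apply P.
Qed.

Lemma Cmod_pair_le (a b : R) : Cmod (a, b) <= Rabs a + Rabs b.
Proof.
  replace (a, b) with (RtoC a + Ci * RtoC b)%C by (apply C_ext; simpl; ring).
  eapply Rle_trans; [apply Cmod_triangle|]. rewrite Cmod_mult, Cmod_Ci, !Cmod_R. lra.
Qed.

(** Compactness of the disk: each point (u,v) of the square around it gets a
    radius within which either |G| stays above half its value at (u,v), or all
    points lie outside the disk. *)
Lemma min_modulus (G : nat -> C) (tau sigma : R) :
  analytic_in tau G -> 0 <= sigma < tau ->
  (forall z, Cmod z <= sigma -> ev G z <> RtoC 0) ->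
  exists kappa, 0 < kappa /\ forall z, Cmod z <= sigma -> kappa <= Cmod (ev G z).
Proof.
  intros HG Hs Hnz.
  destruct (ev_lipschitz G tau sigma HG Hs) as [L [HL0 HL]].
  set (rho := fun u v : R => if Rle_dec (Cmod (u, v)) sigma then Cmod (ev G (u, v)) / (4 * L)
                             else (Cmod (u, v) - sigma) / 4).
  assert (Hrho : forall u v, 0 < rho u v).
  { intros u v. unfold rho. destruct (Rle_dec (Cmod (u, v)) sigma) as [H|H]; [|lra].
    apply Rdiv_lt_0_compat; [|lra]. apply Cmod_gt_0, Hnz, H. }
  destruct (compactness_value_2d (- sigma) sigma (- sigma) sigma
              (fun u v => mkposreal _ (Hrho u v))) as [d Hd].
  exists (2 * L * d). split; [pose proof (cond_pos d); apply Rmult_lt_0_compat; lra|].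
  intros [x y] Hz.
  assert (Hx : Rabs x <= sigma) by (apply Rle_trans with (2 := Hz), (re_le_Cmod (x, y))).
  assert (Hy : Rabs y <= sigma) by (apply Rle_trans with (2 := Hz), (im_le_Cmod (x, y))).
  apply Rnot_lt_le. intros Hlt. apply (Hd x y).
  - apply Rabs_le_between; auto.
  - apply Rabs_le_between; auto.
  - intros [u [v [_ [_ [Hu [Hv Huv]]]]]]. simpl in Hu, Hv, Huv.
    assert (Hdist : Cmod ((u, v) - (x, y)) <= 2 * rho u v).
    { replace ((u, v) - (x, y))%C with ((- (x - u), - (y - v)) : C) by (apply C_ext; simpl; ring).
      eapply Rle_trans; [apply Cmod_pair_le|]. rewrite !Rabs_Ropp. lra. }
    revert Hdist Huv. unfold rho. clear Hu Hv.
    destruct (Rle_dec (Cmod (u, v)) sigma) as [H|H]; intros Hdist Huv.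
    + pose proof (HL _ _ H Hz) as D.
      pose proof (Cmod_triangle (ev G (u, v) - ev G (x, y)) (ev G (x, y))) as T.
      replace (ev G (u, v) - ev G (x, y) + ev G (x, y))%C with (ev G (u, v)) in T by ring.
      assert (D2 : L * Cmod ((u, v) - (x, y)) <= L * (2 * (Cmod (ev G (u, v)) / (4 * L))))
        by (apply Rmult_le_compat_l; lra).
      replace (L * (2 * (Cmod (ev G (u, v)) / (4 * L)))) with (Cmod (ev G (u, v)) / 2) in D2 by (field; lra).
      assert (D3 : 2 * L * d <= 2 * L * (Cmod (ev G (u, v)) / (4 * L)))
        by (apply Rmult_le_compat_l; lra).
      replace (2 * L * (Cmod (ev G (u, v)) / (4 * L))) with (Cmod (ev G (u, v)) / 2) in D3 by (field; lra).
      lra.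
    + pose proof (Cmod_triangle ((u, v) - (x, y)) (x, y)) as T.
      replace ((u, v) - (x, y) + (x, y))%C with ((u, v) : C) in T by (apply C_ext; simpl; ring).
      lra.
Qed.

(** * Quotients of dominated functions *)

Definition dominates (t : R) (F G : nat -> C) : Prop :=
  analytic_in t F /\ analytic_in t G /\
  forall z, Cmod z < t -> Cmod (ev F z) <= Cmod (ev G z).

(** By continuity, domination extends over one exceptional point; this allows
    common zeros to be divided out. *)
Lemma dominates_punctured (t : R) (F G : nat -> C) (w : C) :
  analytic_in t F -> analytic_in t G -> Cmod w < t ->
  (forall z, Cmod z < t -> z <> w -> Cmod (ev F z) <= Cmod (ev G z)) ->
  dominates t F G.
Proof.
  intros HF HG Hw H. split; [|split]; auto. intros z Hz.
  destruct (classic (z = w)) as [->|Hne]; [|auto].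
  pose proof (Cmod_ge_0 w) as Hw0. set (s := (Cmod w + t) / 2).
  destruct (ev_lipschitz F t s HF) as [L1 [HL1 K1]]; [unfold s; lra|].
  destruct (ev_lipschitz G t s HG) as [L2 [HL2 K2]]; [unfold s; lra|].
  apply Rnot_lt_le. intros Hlt. set (e := Cmod (ev F w) - Cmod (ev G w)).
  set (h := Rmin (s - Cmod w) (e / (2 * (L1 + L2)))).
  assert (Hh : 0 < h).
  { apply Rmin_pos; [unfold s; lra|]. apply Rdiv_lt_0_compat; unfold e; lra. }
  assert (Hh1 : h <= s - Cmod w) by apply Rmin_l.
  assert (Hh2 : (L1 + L2) * h <= e / 2).
  { apply Rle_trans with ((L1 + L2) * (e / (2 * (L1 + L2)))).
    - apply Rmult_le_compat_l; [lra | apply Rmin_r].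
    - right. field. lra. }
  set (v := (w + RtoC h)%C).
  assert (Hv : Cmod v <= s).
  { unfold v. eapply Rle_trans; [apply Cmod_triangle|]. rewrite Cmod_real; lra. }
  assert (Hd : Cmod (w - v) = h).
  { unfold v. replace (w - (w + RtoC h))%C with (- RtoC h)%C by ring.
    rewrite Cmod_opp, Cmod_real; lra. }
  assert (Hvw : v <> w).
  { intros E. rewrite E in Hd. replace (w - w)%C with (RtoC 0) in Hd by ring.
    rewrite Cmod_0 in Hd. lra. }
  specialize (H v ltac:(unfold s in *; lra) Hvw).
  specialize (K1 w v ltac:(unfold s; lra) Hv). rewrite Hd in K1.
  specialize (K2 v w Hv ltac:(unfold s; lra)).
  replace (v - w)%C with (- (w - v))%C in K2 by ring. rewrite Cmod_opp, Hd in K2.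
  pose proof (Cmod_triangle (ev F w - ev F v) (ev F v)) as T1.
  replace (ev F w - ev F v + ev F v)%C with (ev F w) in T1 by ring.
  pose proof (Cmod_triangle (ev G v - ev G w) (ev G w)) as T2.
  replace (ev G v - ev G w + ev G w)%C with (ev G v) in T2 by ring.
  unfold e in *. lra.
Qed.

Definition linear (a b : C) : nat -> C :=
  fun n => match n with O => a | S O => b | _ => RtoC 0 end.

Lemma conv_null_l (a b : nat -> C) (n : nat) : (forall k, a k = RtoC 0) -> conv a b n = RtoC 0.
Proof.
  revert a. induction n as [|n IH]; intros a H; simpl; rewrite H; [ring|].
  rewrite (IH (tl a)); [ring|]. intros k; apply H.
Qed.

Lemma conv_linear (a b : C) (u : nat -> C) (n : nat) :
  conv (linear a b) u (S n) = (a * u (S n) + b * u n)%C.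
Proof.
  simpl. f_equal. destruct n as [|n]; [reflexivity|].
  simpl. rewrite (conv_null_l (tl (tl (linear a b)))); [|reflexivity].
  unfold tl. simpl. ring.
Qed.

Lemma summ_at_linear (a b : C) (r : R) : summ_at r (linear a b).
Proof.
  apply (ex_series_incr_1 (fun n => Cmod (linear a b n) * r ^ n)).
  apply (ex_series_incr_1 (fun n => Cmod (linear a b (S n)) * r ^ S n)).
  apply ex_series_eq with (fun n => 0 * 0 ^ n).
  - intros n. simpl. rewrite Cmod_0. ring.
  - apply ex_series_scal_R, ex_series_geom. rewrite Rabs_R0. lra.
Qed.

Lemma ev_linear (a b z : C) : ev (linear a b) z = (a + b * z)%C.
Proof.
  rewrite ev_head by apply summ_at_linear.
  rewrite ev_head by (apply summ_at_tail; [apply Cmod_ge_0 | apply summ_at_linear]).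
  rewrite ev_null by reflexivity. unfold tl. simpl. ring.
Qed.

Lemma analytic_in_conv (t : R) (u v : nat -> C) :
  analytic_in t u -> analytic_in t v -> analytic_in t (conv u v).
Proof. intros Hu Hv r Hr. apply summ_at_conv; [lra | apply Hu; auto | apply Hv; auto]. Qed.

Lemma conv_cancel (a u v : nat -> C) : a O <> RtoC 0 ->
  (forall n, conv a u n = conv a v n) -> forall n, u n = v n.
Proof.
  intros Ha H n. destruct (ps_inverse_exists a Ha) as [b Hb].
  assert (E : forall x n, conv b (conv a x) n = x n).
  { intros x k. rewrite <- conv_assoc, (conv_ext (conv b a) ps_one x x); auto.
    apply conv_ps_one_l. }
  rewrite <- (E u n), <- (E v n). apply conv_ext; auto.
Qed.

(** The formal quotient of F by z - w, for w <> 0. *)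
Fixpoint divide_root (w : C) (F : nat -> C) (n : nat) : C :=
  match n with
  | O => (- (F O / w))%C
  | S p => ((divide_root w F p - F (S p)) / w)%C
  end.

Lemma divide_root_spec (w : C) (F : nat -> C) (n : nat) : w <> RtoC 0 ->
  conv (linear (- w) (RtoC 1)) (divide_root w F) n = F n.
Proof.
  intros Hw. destruct n as [|n].
  - simpl. field. auto.
  - rewrite conv_linear. simpl. field. auto.
Qed.

(** The quotient by z - w has the partial sums of F(w), up to sign, as its
    coefficients scaled by w^(n+1); when F(w) = 0 these are also the tails. *)
Lemma divide_root_partial (w : C) (F : nat -> C) (n : nat) : w <> RtoC 0 ->
  (divide_root w F n * w ^ S n = - fsum (fun k => F k * w ^ k) (S n))%C.
Proof.
  intros Hw. induction n as [|n IH].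
  - simpl. field. auto.
  - change (fsum (fun k => F k * w ^ k)%C (S (S n)))
      with (fsum (fun k => F k * w ^ k)%C (S n) + F (S n) * w ^ S n)%C.
    replace (- (fsum (fun k => F k * w ^ k) (S n) + F (S n) * w ^ S n))%C
      with (- fsum (fun k => F k * w ^ k) (S n) - F (S n) * w ^ S n)%C by ring.
    rewrite <- IH. simpl. field. auto.
Qed.

(** Written with the tails of the series F(w) = 0, the coefficients of the
    quotient satisfy the same geometric bounds as those of F. *)
Lemma analytic_divide_root (w : C) (F : nat -> C) (t : R) : w <> RtoC 0 ->
  analytic_in t F -> Cmod w < t -> ev F w = RtoC 0 -> analytic_in t (divide_root w F).
Proof.
  intros Hw HF Hwt H0 r0 Hr0. assert (Hw0 := proj1 (Cmod_gt_0 w) Hw).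
  set (m0 := Rmax r0 (Cmod w)). set (r := (m0 + t) / 2).
  assert (Hm : m0 < t) by (apply Rmax_lub_lt; lra).
  assert (Hm1 : r0 <= m0) by apply Rmax_l. assert (Hm2 : Cmod w <= m0) by apply Rmax_r.
  assert (Sr : summ_at r F) by (apply HF; unfold r; lra).
  set (M := Series (fun n => Cmod (F n) * r ^ n)).
  assert (Hr : 0 < r) by (unfold r; lra).
  apply (analytic_in_bounded _ r (M / r)); auto; [|unfold r; lra].
  intros n.
  assert (Sw : abs_summable (fun k => F k * w ^ k)%C) by (apply summ_at_terms, HF; lra).
  destruct (csum_split _ (S n) Sw) as [E St].
  fold (ev F w) in E. rewrite H0 in E.
  pose proof (divide_root_partial w F n Hw) as P.
  assert (E2 : (divide_root w F n * w ^ S n)%C = csum (fun k => F (S n + k)%nat * w ^ (S n + k))%C).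
  { rewrite P. set (A := fsum _ _) in *. set (B := csum _) in *.
    replace B with (A + B - A)%C by ring. rewrite <- E. ring. }
  apply (f_equal Cmod) in E2. rewrite Cmod_mult, Cmod_pow in E2.
  assert (Str : ex_series (fun k => Cmod (F (S n + k)%nat) * r ^ (S n + k))).
  { apply (ex_series_incr_n (fun k => Cmod (F k) * r ^ k)). exact Sr. }
  assert (HW : 0 < Cmod w ^ S n) by (apply pow_lt; auto).
  assert (HR : 0 < r ^ S n) by (apply pow_lt; auto).
  assert (Htail : Series (fun k => Cmod (F (S n + k)%nat) * r ^ (S n + k)) <= M).
  { unfold M. rewrite (Series_incr_n (fun k => Cmod (F k) * r ^ k) (S n)) by (auto; lia).
    assert (0 <= sum_f_R0 (fun k => Cmod (F k) * r ^ k) (pred (S n))).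
    { apply cond_pos_sum. intros k. apply term_ge_0. lra. }
    lra. }
  assert (Hq : Cmod (divide_root w F n) * r ^ S n <= M).
  { apply Rle_trans with (2 := Htail).
    apply Rmult_le_reg_r with (Cmod w ^ S n); auto.
    replace (Cmod (divide_root w F n) * r ^ S n * Cmod w ^ S n)
      with (r ^ S n * (Cmod (divide_root w F n) * Cmod w ^ S n)) by ring.
    rewrite E2, (Rmult_comm (Series _)), <- Series_scal_l.
    apply Rle_trans with (r ^ S n * Series (fun k => Cmod (F (S n + k)%nat * w ^ (S n + k))%C)).
    { apply Rmult_le_compat_l; [lra | apply Cmod_csum_le; exact St]. }
    rewrite <- Series_scal_l. apply Series_le.
    - intros k. split; [apply Rmult_le_pos; [lra | apply Cmod_ge_0]|].
      rewrite Cmod_mult, Cmod_pow, !(pow_add _ (S n) k).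
      assert (Cmod w ^ k <= r ^ k) by (apply pow_incr; unfold r; lra).
      replace (r ^ S n * (Cmod (F (S n + k)%nat) * (Cmod w ^ S n * Cmod w ^ k)))
        with ((r ^ S n * Cmod (F (S n + k)%nat) * Cmod w ^ S n) * Cmod w ^ k) by ring.
      replace (Cmod w ^ S n * (Cmod (F (S n + k)%nat) * (r ^ S n * r ^ k)))
        with ((r ^ S n * Cmod (F (S n + k)%nat) * Cmod w ^ S n) * r ^ k) by ring.
      apply Rmult_le_compat_l; auto.
      apply Rmult_le_pos; [apply Rmult_le_pos|]; try lra. apply Cmod_ge_0.
    - apply ex_series_scal_R, Str. }
  apply Rmult_le_reg_r with r; auto. unfold Rdiv. rewrite (Rmult_assoc M), Rinv_l, Rmult_1_r by lra.
  simpl in Hq. lra.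
Qed.

(** The partial sums of the squared Hardy space norm. *)
Definition energy (u : nat -> C) (N : nat) : R := sum_f_R0 (fun n => Cmod (u n) ^ 2) N.

(** A Blaschke factor has modulus 1 on the unit circle; this is the identity
    behind that fact, for consecutive coefficients a and b. *)
Lemma blaschke_identity (a b w : C) :
  Cmod (a + - Cconj w * b) ^ 2 =
  Cmod (- w * a + b) ^ 2 + (1 - Cmod w ^ 2) * (Cmod a ^ 2 - Cmod b ^ 2).
Proof.
  rewrite !Cmod2_alt. destruct a as [a1 a2], b as [b1 b2], w as [w1 w2]. simpl. ring.
Qed.

(** Replacing the factor z - w by 1 - conj(w) z preserves the Hardy space norm:
    the defect of the partial sums telescopes to a boundary term. *)
Lemma energy_blaschke (w : C) (Q : nat -> C) (N : nat) :
  energy (conv (linear (RtoC 1) (- Cconj w)) Q) N =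
  energy (conv (linear (- w) (RtoC 1)) Q) N + (1 - Cmod w ^ 2) * Cmod (Q N) ^ 2.
Proof.
  unfold energy. induction N as [|N IH].
  - simpl sum_f_R0. simpl conv. rewrite !Cmod_mult, Cmod_opp, Cmod_1. ring.
  - rewrite !tech5, IH, !conv_linear.
    rewrite !Cmult_1_l.
    rewrite blaschke_identity. ring.
Qed.

Lemma energy_le (u : nat -> C) (N M : nat) : (N <= M)%nat -> energy u N <= energy u M.
Proof.
  intros H. induction H as [|M H IH]; [lra|]. unfold energy in *. rewrite tech5.
  pose proof (pow2_ge_0 (Cmod (u (S M)))). lra.
Qed.

Lemma energy_blaschke_le (w : C) (Q : nat -> C) (t B : R) : 1 < t -> analytic_in t Q ->
  Cmod w <= 1 ->
  (forall N, energy (conv (linear (- w) (RtoC 1)) Q) N <= B) ->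
  forall N, energy (conv (linear (RtoC 1) (- Cconj w)) Q) N <= B.
Proof.
  intros Ht HQ Hw HB N. apply Rnot_lt_le. intros Hlt.
  set (e := energy (conv (linear (RtoC 1) (- Cconj w)) Q) N - B) in *.
  assert (S1 : ex_series (fun n => Cmod (Q n))).
  { apply ex_series_eq with (2 := HQ 1 ltac:(lra)). intros n. rewrite pow1. ring. }
  apply ex_series_lim_0, is_lim_seq_spec in S1.
  destruct (S1 (mkposreal (Rmin 1 e) ltac:(apply Rmin_pos; unfold e; lra))) as [M0 HM].
  set (M := Nat.max N M0). specialize (HM M ltac:(lia)). simpl in HM.
  rewrite Rminus_0_r, Rabs_pos_eq in HM by apply Cmod_ge_0.
  pose proof (Rmin_l 1 e). pose proof (Rmin_r 1 e). pose proof (Cmod_ge_0 (Q M)) as HQ0.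
  assert (E2 : Cmod (Q M) ^ 2 < e).
  { simpl. rewrite Rmult_1_r. apply Rle_lt_trans with (1 * Cmod (Q M)); [apply Rmult_le_compat_r|]; lra. }
  pose proof (energy_le (conv (linear (RtoC 1) (- Cconj w)) Q) N M ltac:(lia)) as M1.
  rewrite (energy_blaschke w Q M) in M1. specialize (HB M).
  assert (Hw2 : 0 <= Cmod w ^ 2) by apply pow2_ge_0.
  assert (Hq2 : 0 <= Cmod (Q M) ^ 2) by apply pow2_ge_0.
  assert ((1 - Cmod w ^ 2) * Cmod (Q M) ^ 2 <= 1 * Cmod (Q M) ^ 2)
    by (apply Rmult_le_compat_r; lra).
  unfold e in *. lra.
Qed.

Definition schur_quotient (t : R) (F G : nat -> C) : Prop :=
  exists phi, analytic_in t phi /\ (forall z, Cmod z < t -> Cmod (ev phi z) <= 1) /\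
              (forall n, conv phi G n = F n).

(** Here F/G is F times the reciprocal of G, and |F/G| <= 1 holds pointwise. *)
Lemma schur_quotient_zero_free (F G : nat -> C) (tau sigma : R) : 0 < sigma < tau ->
  dominates tau F G -> (forall z, Cmod z <= sigma -> ev G z <> RtoC 0) ->
  schur_quotient sigma F G.
Proof.
  intros Hs [HF [HG Hd]] Hnz.
  destruct (min_modulus G tau sigma HG ltac:(lra) Hnz) as [kappa [Hk Hmin]].
  assert (G0 : G O <> RtoC 0).
  { rewrite <- ev_at_0. apply Hnz. rewrite Cmod_0. lra. }
  destruct (ps_inverse_exists G G0) as [v Hv].
  pose proof (inverse_of_zero_free G v tau sigma kappa HG Hs Hk Hmin Hv) as Av.
  assert (AF : analytic_in sigma F) by (intros r Hr; apply HF; lra).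
  assert (Aphi : analytic_in sigma (conv F v)) by (apply analytic_in_conv; auto).
  assert (E : forall n, conv (conv F v) G n = F n).
  { intros n. rewrite conv_assoc, (conv_ext F F (conv v G) ps_one); auto. apply conv_ps_one_r. }
  exists (conv F v). split; [|split]; auto.
  intros z Hz. pose proof (Cmod_ge_0 z) as Hz0.
  assert (E2 : (ev (conv F v) z * ev G z)%C = ev F z).
  { rewrite <- ev_conv by (try apply Aphi; try apply HG; lra). apply ev_ext, E. }
  apply (f_equal Cmod) in E2. rewrite Cmod_mult in E2.
  specialize (Hd z ltac:(lra)). specialize (Hmin z ltac:(lra)).
  apply Rmult_le_reg_r with (Cmod (ev G z)); lra.
Qed.

(** Removal of the zeros of G in the closed disk of radius sigma. A zero w of G
    is a zero of F; replacing the factor z - w of both by 1 - conj(w) z changes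
    neither F/G nor the domination nor the bound B on the norm of G, while
    |G(0)| is multiplied by 1/|w| >= 1/sigma. Since |G(0)|^2 <= B always holds,
    fewer than k replacements are possible when |G(0)|^2 > B sigma^(2k). *)
Lemma schur_quotient_radius_gt1 (tau sigma B : R) : 1 < tau -> 0 < sigma < 1 ->
  forall k F G, dominates tau F G -> (forall N, energy G N <= B) ->
  B * (sigma ^ 2) ^ k < Cmod (G O) ^ 2 -> schur_quotient sigma F G.
Proof.
  intros Ht Hs. induction k as [|k IH]; intros F G Hdom HB HG0.
  { specialize (HB 0%nat). unfold energy in HB. simpl in HB, HG0. lra. }
  destruct (classic (exists w, Cmod w <= sigma /\ ev G w = RtoC 0)) as [[w [Hw Hw0]]|Hno].
  2: { apply schur_quotient_zero_free with tau; auto; [lra|].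
       intros z Hz E. apply Hno. exists z; auto. }
  assert (B0 : 0 <= B).
  { apply Rle_trans with (2 := HB 0%nat). apply pow2_ge_0. }
  assert (Hs2 : 0 < sigma ^ 2) by (apply pow_lt; lra).
  assert (Hsk : 0 <= B * (sigma ^ 2) ^ k) by (apply Rmult_le_pos; [auto | left; apply pow_lt; auto]).
  assert (Hsk1 : 0 <= B * (sigma ^ 2) ^ S k) by (apply Rmult_le_pos; [auto | left; apply pow_lt; auto]).
  assert (G0 : G O <> RtoC 0).
  { intros E. rewrite E, Cmod_0 in HG0. simpl in HG0, Hsk1. lra. }
  assert (Hwn : w <> RtoC 0).
  { intros E. rewrite E, ev_at_0 in Hw0. auto. }
  destruct Hdom as [HF [HG Hd]].
  assert (HFw : ev F w = RtoC 0).
  { apply Cmod_eq_0. specialize (Hd w ltac:(lra)). rewrite Hw0, Cmod_0 in Hd.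
    pose proof (Cmod_ge_0 (ev F w)). lra. }
  set (QF := divide_root w F). set (QG := divide_root w G).
  assert (AF : analytic_in tau QF) by (apply analytic_divide_root; auto; lra).
  assert (AG : analytic_in tau QG) by (apply analytic_divide_root; auto; lra).
  set (l1 := linear (- w) (RtoC 1)). set (l2 := linear (RtoC 1) (- Cconj w)).
  assert (EF : forall n, conv l1 QF n = F n) by (intros; apply divide_root_spec; auto).
  assert (EG : forall n, conv l1 QG n = G n) by (intros; apply divide_root_spec; auto).
  assert (Al : forall a b, analytic_in tau (linear a b)) by (intros a b r _; apply summ_at_linear).
  assert (D1 : dominates tau QF QG).
  { apply dominates_punctured with w; auto; [lra|].
    intros z Hz Hzw. pose proof (Cmod_ge_0 z) as Hz0.
    specialize (Hd z Hz).
    rewrite <- (ev_ext _ F z EF), <- (ev_ext _ G z EG) in Hd.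
    rewrite !ev_conv in Hd by (try apply AF; try apply AG; try apply Al; lra).
    unfold l1 in Hd. rewrite ev_linear, !Cmod_mult in Hd.
    apply Rmult_le_reg_l with (2 := Hd). apply Cmod_gt_0.
    intros E. apply Hzw. replace z with (- w + 1 * z + w)%C by ring. rewrite E. ring. }
  assert (D2 : dominates tau (conv l2 QF) (conv l2 QG)).
  { split; [|split]; try (apply analytic_in_conv; auto; apply Al).
    intros z Hz. pose proof (Cmod_ge_0 z) as Hz0. destruct D1 as [_ [_ D1]].
    rewrite !ev_conv by (try apply AF; try apply AG; try apply Al; lra).
    rewrite !Cmod_mult. apply Rmult_le_compat_l; [apply Cmod_ge_0 | auto]. }
  destruct (IH (conv l2 QF) (conv l2 QG) D2) as [phi [Hphi [Bphi Ephi]]].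
  - apply (energy_blaschke_le w QG tau B); auto; [lra|].
    intros N. eapply Rle_trans; [|apply (HB N)]. right.
    apply sum_eq. intros i _. fold l1. rewrite EG. reflexivity.
  - assert (E : G O = (- w * QG O)%C) by (rewrite <- (EG O); reflexivity).
    rewrite E, Cmod_mult, Cmod_opp, Rpow_mult_distr in HG0.
    unfold l2. simpl conv. rewrite Cmult_1_l.
    assert (Hw2 : Cmod w ^ 2 <= sigma ^ 2) by (apply pow_incr; split; [apply Cmod_ge_0|auto]).
    assert (Hwp : 0 < Cmod w ^ 2) by (apply pow_lt, Cmod_gt_0; auto).
    apply Rmult_lt_reg_l with (Cmod w ^ 2); auto.
    apply Rle_lt_trans with (2 := HG0). simpl pow at 3.
    replace (B * ((sigma ^ 2) ^ S k)) with (sigma ^ 2 * (B * (sigma ^ 2) ^ k)) by (simpl; ring).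
    apply Rmult_le_compat_r; auto.
  - exists phi. split; [|split]; auto.
    (* the new factor l2 is invertible, so it cancels from the equation for phi *)
    assert (EQ : forall n, conv phi QG n = QF n).
    { apply (conv_cancel l2); [unfold l2; simpl; intros E; injection E; lra|].
      intros n. rewrite <- Ephi, <- !conv_assoc. apply conv_ext; [apply conv_comm|reflexivity]. }
    intros n. rewrite <- EF.
    rewrite (conv_ext phi phi G (conv l1 QG)) by auto.
    rewrite <- conv_assoc, (conv_ext (conv phi l1) (conv l1 phi) QG QG) by (auto; apply conv_comm).
    rewrite conv_assoc. apply conv_ext; auto.
Qed.

Lemma sum_le_Series (a : nat -> R) (N : nat) : (forall n, 0 <= a n) -> ex_series a ->
  sum_f_R0 a N <= Series a.
Proof.
  intros Ha E. rewrite (Series_incr_n a (S N)) by (auto; lia). simpl pred.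
  assert (0 <= Series (fun k => a (S N + k)%nat)).
  { apply Series_nonneg; auto. apply (ex_series_incr_n a (S N)). exact E. }
  lra.
Qed.

Lemma energy_bounded (u : nat -> C) : summ_at 1 u -> exists B, forall N, energy u N <= B.
Proof.
  intros H.
  assert (S1 : ex_series (fun n => Cmod (u n))).
  { apply ex_series_eq with (2 := H). intros n. rewrite pow1. ring. }
  destruct (ex_series_bounded _ S1) as [M HM].
  exists (Series (fun n => M * Cmod (u n))). intros N.
  assert (P : forall n, 0 <= M * Cmod (u n)).
  { intros n. apply Rmult_le_pos; [|apply Cmod_ge_0].
    apply Rle_trans with (2 := HM n). apply Rabs_pos. }
  apply Rle_trans with (sum_f_R0 (fun n => M * Cmod (u n)) N).
  - apply sum_Rle. intros n _. specialize (HM n). rewrite Rabs_pos_eq in HM by apply Cmod_ge_0.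
    simpl. rewrite Rmult_1_r. apply Rmult_le_compat_r; auto. apply Cmod_ge_0.
  - apply sum_le_Series; auto. apply ex_series_scal_R, S1.
Qed.

(** The formal quotient phi is treated on each disk of radius s < 1 by scaling
    with some rho between s and 1, which makes F and G analytic in a disk of
    radius 1/rho > 1. *)
Lemma schur_quotient_nonvanishing_at_0 (F G : nat -> C) : G O <> RtoC 0 ->
  dominates 1 F G -> schur_quotient 1 F G.
Proof.
  intros G0 [HF [HG Hd]].
  destruct (ps_inverse_exists G G0) as [v Hv]. set (phi := conv F v).
  assert (E : forall n, conv phi G n = F n).
  { intros n. unfold phi. rewrite conv_assoc, (conv_ext F F (conv v G) ps_one); auto.
    apply conv_ps_one_r. }
  assert (Key : forall s, 0 < s < 1 -> exists rho, s < rho < 1 /\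
            analytic_in (s / rho) (scl rho phi) /\
            forall z, Cmod z < s / rho -> Cmod (ev (scl rho phi) z) <= 1).
  { intros s Hs. set (rho := (s + 1) / 2). exists rho.
    assert (Hr : s < rho < 1) by (unfold rho; lra).
    assert (Hsg : 0 < s / rho < 1).
    { split; [apply Rdiv_lt_0_compat; lra|]. apply Rmult_lt_reg_r with rho; [lra|].
      unfold Rdiv. rewrite Rmult_assoc, Rinv_l; lra. }
    assert (Ht : 1 < / rho) by (rewrite <- Rinv_1; apply Rinv_lt_contravar; lra).
    assert (As : forall u, analytic_in 1 u -> analytic_in (/ rho) (scl rho u)).
    { intros u Hu r Hr'. apply summ_at_scl; [lra|]. apply Hu.
      split; [apply Rmult_le_pos; lra|].
      apply Rmult_lt_reg_r with (/ rho); [lra|]. rewrite Rmult_assoc, Rinv_r; lra. }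
    assert (Hdom : dominates (/ rho) (scl rho F) (scl rho G)).
    { split; [|split]; auto. intros z Hz. rewrite !ev_scl. apply Hd.
      rewrite Cmod_mult, Cmod_real by lra.
      apply Rmult_lt_reg_r with (/ rho); [lra|]. rewrite Rmult_assoc, Rinv_r; lra. }
    destruct (energy_bounded (scl rho G)) as [B HB]; [apply As; auto; lra|].
    assert (G0' : 0 < Cmod (scl rho G O) ^ 2).
    { apply pow_lt. rewrite Cmod_scl by lra. simpl. rewrite Rmult_1_r. apply Cmod_gt_0; auto. }
    assert (B0 : 0 <= B) by (apply Rle_trans with (2 := HB 0%nat), pow2_ge_0).
    destruct (pow_lt_1_zero ((s / rho) ^ 2)) with (y := Cmod (scl rho G O) ^ 2 / (B + 1)) as [k Hk].
    { rewrite Rabs_pos_eq by apply pow2_ge_0. simpl. rewrite Rmult_1_r.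
      apply Rlt_le_trans with (1 * 1); [|lra]. apply Rmult_gt_0_lt_compat; lra. }
    { apply Rdiv_lt_0_compat; lra. }
    specialize (Hk k ltac:(lia)).
    assert (Hpk : 0 < ((s / rho) ^ 2) ^ k) by (apply pow_lt, pow_lt; lra).
    rewrite Rabs_pos_eq in Hk by lra.
    destruct (schur_quotient_radius_gt1 (/ rho) (s / rho) B Ht Hsg k _ _ Hdom HB) as [psi [A1 [A2 A3]]].
    { assert (H2 : ((s / rho) ^ 2) ^ k * (B + 1) < Cmod (scl rho G O) ^ 2).
      { apply (Rmult_lt_compat_r (B + 1)) in Hk; [|lra].
        replace (Cmod (scl rho G O) ^ 2 / (B + 1) * (B + 1)) with (Cmod (scl rho G O) ^ 2) in Hk
          by (field; lra).
        exact Hk. }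
      lra. }
    assert (Epsi : forall n, psi n = scl rho phi n).
    { apply (conv_cancel (scl rho G)).
      - unfold scl. simpl. rewrite Cmult_1_r. auto.
      - intros n. rewrite !(conv_comm (scl rho G)), A3, conv_scl. unfold scl. rewrite E. reflexivity. }
    split; auto. split.
    - intros r Hr'. apply summ_at_ext with psi; auto.
    - intros z Hz. rewrite <- (ev_ext psi _ z Epsi). auto. }
  exists phi. split; [|split]; auto.
  - intros r Hr. set (s := (r + 1) / 2).
    destruct (Key s ltac:(unfold s; lra)) as [rho [Hr' [A1 A2]]].
    assert (Hs : 0 < s) by (unfold s; lra).
    apply (analytic_in_bounded phi s 1 Hs); [|unfold s; lra]. intros n.
    pose proof (cauchy_estimate (scl rho phi) (s / rho) 1 n ltac:(apply Rdiv_lt_0_compat; lra) A1 A2) as Ce.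
    rewrite Cmod_scl, Rmult_assoc, <- Rpow_mult_distr in Ce by lra.
    replace (rho * (s / rho)) with s in Ce by (field; lra). exact Ce.
  - intros z Hz. pose proof (Cmod_ge_0 z) as Hz0. set (s := (Cmod z + 1) / 2).
    destruct (Key s ltac:(unfold s; lra)) as [rho [Hr' [A1 A2]]].
    assert (Hrho : 0 < rho) by (unfold s in Hr'; lra).
    assert (Hi : 0 < / rho) by (apply Rinv_0_lt_compat; lra).
    specialize (A2 (z * RtoC (/ rho))%C). rewrite ev_scl in A2.
    replace (z * RtoC (/ rho) * RtoC rho)%C with z in A2.
    2: { rewrite <- Cmult_assoc, <- RtoC_mult, Rinv_l by lra. ring. }
    apply A2. rewrite Cmod_mult, Cmod_real by lra. unfold Rdiv.
    apply Rmult_lt_compat_r; auto. unfold s; lra.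
Qed.

Lemma analytic_in_tail (t : R) (u : nat -> C) : analytic_in t u -> analytic_in t (tl u).
Proof. intros H r Hr. apply summ_at_tail; [lra | apply H; auto]. Qed.

(** A function dominated by G on the unit disk is the product of G and a
    function bounded by 1: removable singularities, at the level of power
    series. A zero of G at 0 is divided out of both functions by a shift of the
    coefficients; if G vanishes identically, so does F. *)
Theorem schur_quotient_exists (F G : nat -> C) : dominates 1 F G -> schur_quotient 1 F G.
Proof.
  intros Hdom.
  destruct (classic (exists p, G p <> RtoC 0)) as [[p Hp]|Hno].
  - revert F G Hdom Hp. induction p as [|p IH]; intros F G Hdom Hp.
    { apply schur_quotient_nonvanishing_at_0; auto. }
    destruct (classic (G O = RtoC 0)) as [G0|G0].
    2: { apply schur_quotient_nonvanishing_at_0; auto. }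
    destruct Hdom as [HF [HG Hd]].
    assert (F0 : F O = RtoC 0).
    { apply Cmod_eq_0. specialize (Hd (RtoC 0) ltac:(rewrite Cmod_0; lra)).
      rewrite !ev_at_0, G0, Cmod_0 in Hd. pose proof (Cmod_ge_0 (F O)). lra. }
    destruct (IH (tl F) (tl G)) as [phi [A1 [A2 A3]]].
    + apply dominates_punctured with (RtoC 0); try (apply analytic_in_tail; auto).
      * rewrite Cmod_0. lra.
      * intros z Hz Hz0. specialize (Hd z Hz). pose proof (Cmod_ge_0 z).
        rewrite (ev_head F), (ev_head G), F0, G0, !Cplus_0_l, !Cmod_mult in Hd
          by (try apply HF; try apply HG; lra).
        apply Rmult_le_reg_l with (2 := Hd). apply Cmod_gt_0; auto.
    + exact Hp.
    + exists phi. split; [|split]; auto. intros [|n].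
      * simpl. rewrite F0, G0. ring.
      * rewrite conv_last, A3, G0. unfold tl. ring.
  - assert (GZ : forall n, G n = RtoC 0).
    { intros n. apply NNPP. intros H. apply Hno. exists n; auto. }
    destruct Hdom as [HF [HG Hd]].
    assert (FZ : forall n, F n = RtoC 0).
    { intros n. apply Cmod_eq_0.
      pose proof (cauchy_estimate F 1 0 n Rlt_0_1 HF) as Ce.
      rewrite pow1, Rmult_1_r in Ce. pose proof (Cmod_ge_0 (F n)).
      apply Rle_antisym; auto. apply Ce. intros z Hz.
      specialize (Hd z Hz). rewrite (ev_null G z GZ), Cmod_0 in Hd. exact Hd. }
    exists (fun _ => RtoC 0). split; [|split].
    + intros r Hr. apply summ_at_zero. lra.
    + intros z _. rewrite ev_null, Cmod_0 by reflexivity. lra.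
    + intros n. rewrite conv_null_l by reflexivity. auto.
Qed.

(** * Majorant series and the Bohr radius *)

Lemma sum_convR_le (a b : nat -> R) (N : nat) : (forall n, 0 <= a n) -> (forall n, 0 <= b n) ->
  sum_f_R0 (convR a b) N <= sum_f_R0 a N * sum_f_R0 b N.
Proof.
  intros Ha Hb. revert a Ha. induction N as [|N IH]; intros a Ha.
  - simpl. lra.
  - assert (E : sum_f_R0 (convR a b) (S N) =
                a O * sum_f_R0 b (S N) + sum_f_R0 (convR (tl a) b) N).
    { rewrite (decomp_sum (convR a b)), (decomp_sum b) by lia. simpl pred.
      rewrite Rmult_plus_distr_l, scal_sum, Rplus_assoc. simpl convR at 1. f_equal.
      rewrite <- plus_sum. apply sum_eq. intros i _. simpl. ring. }
    rewrite E, (decomp_sum a) by lia. simpl pred. rewrite Rmult_plus_distr_r.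
    apply Rplus_le_compat_l.
    eapply Rle_trans; [apply IH; intros k; apply Ha|].
    apply Rmult_le_compat_l.
    + apply cond_pos_sum. intros k. apply Ha.
    + rewrite tech5. specialize (Hb (S N)). lra.
Qed.

(** The partial sums increase, so they lie below their limit. *)
Lemma majorant_partial_le (r : R) (u : nat -> C) (N : nat) (B : R) : 0 <= r ->
  Rbar_le (majorant_series r u) (Finite B) ->
  sum_f_R0 (fun n => Cmod (u n) * r ^ n) N <= B.
Proof.
  intros Hr H. set (c := sum_f_R0 (fun n => Cmod (u n) * r ^ n) N).
  assert (K : Rbar_le (Lim_seq (fun _ => c)) (majorant_series r u)).
  { apply Lim_seq_le_loc. exists N. intros n Hn. rewrite sum_n_Reals. unfold c.
    induction Hn as [|n Hn IH]; [lra|]. rewrite tech5.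
    pose proof (term_ge_0 u r (S n) Hr). lra. }
  rewrite Lim_seq_const in K. exact (Rbar_le_trans _ _ _ K H).
Qed.

Lemma majorant_le_shift (r : R) (u v : nat -> C) (m : nat) :
  (forall N, sum_f_R0 (fun n => Cmod (u n) * r ^ n) (N + m)
             <= sum_f_R0 (fun n => Cmod (v n) * r ^ n) N) ->
  Rbar_le (majorant_series r u) (majorant_series r v).
Proof.
  intros H. unfold majorant_series. rewrite <- (Lim_seq_incr_n (sum_n _) m) at 1.
  apply Lim_seq_le_loc. exists 0%nat. intros N _. rewrite !sum_n_Reals. apply H.
Qed.

Lemma sum_shift (a : nat -> R) (m N : nat) : (forall n, (n < m)%nat -> a n = 0) ->
  sum_f_R0 a (N + m) = sum_f_R0 (fun n => a (n + m)%nat) N.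
Proof.
  intros H. induction N as [|N IH].
  - simpl. destruct m as [|m]; [reflexivity|]. rewrite tech5.
    replace (sum_f_R0 a m) with 0; [ring|].
    symmetry. apply sum_eq_R0. intros n Hn. apply H. lia.
  - simpl Nat.add. rewrite !tech5, IH. reflexivity.
Qed.

Lemma majorant_monomial (r : R) (a : C) (m : nat) (u : nat -> C) : 0 <= r ->
  u m = a -> forall B, Rbar_le (majorant_series r u) (Finite B) -> Cmod a * r ^ m <= B.
Proof.
  intros Hr Hu B H. pose proof (majorant_partial_le r u m B Hr H) as K.
  eapply Rle_trans; [|exact K]. rewrite <- Hu.
  destruct m as [|m]; [simpl; lra|]. rewrite tech5.
  assert (0 <= sum_f_R0 (fun n => Cmod (u n) * r ^ n) m).
  { apply cond_pos_sum. intros n. apply term_ge_0; auto. }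
  lra.
Qed.

Lemma sup_norm_le (u : nat -> C) (B : R) :
  (forall z, Cmod z < 1 -> Cmod (ps_eval u z) <= B) -> Rbar_le (sup_norm u) (Finite B).
Proof.
  intros H. apply (proj2 (Lub_Rbar_correct _)). intros x [z [Hz ->]]. apply H; auto.
Qed.

Lemma sup_norm_bound (u : nat -> C) (B : R) : Rbar_le (sup_norm u) (Finite B) ->
  forall z, Cmod z < 1 -> Cmod (ps_eval u z) <= B.
Proof.
  intros H z Hz.
  assert (K : Rbar_le (Finite (Cmod (ps_eval u z))) (sup_norm u)).
  { apply (proj1 (Lub_Rbar_correct _)). exists z. auto. }
  exact (Rbar_le_trans _ _ _ K H).
Qed.

Definition monomial (m : nat) (a : C) : nat -> C :=
  fun n => if Nat.eq_dec n m then a else RtoC 0.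

Lemma monomial_starts_at (m : nat) (a : C) : starts_at m (monomial m a).
Proof. intros n Hn. unfold monomial. destruct (Nat.eq_dec n m); [lia|reflexivity]. Qed.

Lemma opA_monomial (m : nat) (h : nat -> C) (a : C) (n : nat) :
  opA m h (monomial m a) n = (h m * a * ps_one n)%C.
Proof.
  unfold opA, hadamard, monomial. destruct (Nat.eq_dec (n + m) m) as [E|E].
  - assert (n = 0)%nat by lia. subst n. simpl. ring.
  - destruct n as [|n]; [lia|]. simpl. ring.
Qed.

Lemma summ_at_shift (r : R) (u : nat -> C) (m : nat) :
  0 <= r -> summ_at r (fun n => u (n + m)%nat) -> summ_at r u.
Proof.
  intros Hr H. apply (ex_series_incr_n (fun n => Cmod (u n) * r ^ n) m).
  apply ex_series_eq with (fun k => r ^ m * (Cmod (u (k + m)%nat) * r ^ k)).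
  - intros n. rewrite (Nat.add_comm m n), pow_add. ring.
  - apply ex_series_scal_R, H.
Qed.

Lemma analytic_ps_one_scal (t : R) (c : C) : analytic_in t (fun n => c * ps_one n)%C.
Proof. intros r Hr. apply summ_at_scal; [lra | apply summ_at_ps_one; lra]. Qed.

Lemma monomial_convergent (m : nat) (a : C) : convergent (monomial m a).
Proof.
  exists 1. split; [lra|]. apply converges_analytic. intros r Hr.
  apply summ_at_shift with m; [lra|].
  apply summ_at_ext with (fun n => a * ps_one n)%C; [|apply (analytic_ps_one_scal 1); auto].
  intros n. unfold monomial. destruct (Nat.eq_dec (n + m) m) as [E|E], n; simpl; try lia; ring.
Qed.

Lemma opA_monomial_analytic (m : nat) (h : nat -> C) (a : C) (t : R) :
  analytic_in t (opA m h (monomial m a)).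
Proof.
  intros r Hr. apply summ_at_ext with (fun n => h m * a * ps_one n)%C.
  - intros n. symmetry. apply opA_monomial.
  - apply (analytic_ps_one_scal t); auto.
Qed.

Lemma ps_eval_opA_monomial (m : nat) (h : nat -> C) (a z : C) : Cmod z < 1 ->
  ps_eval (opA m h (monomial m a)) z = (h m * a)%C.
Proof.
  intros Hz. pose proof (Cmod_ge_0 z).
  rewrite ps_eval_ev by (apply (opA_monomial_analytic m h a 1); lra).
  rewrite (ev_ext _ (fun n => h m * a * ps_one n)%C) by apply opA_monomial.
  rewrite ev_scal by (apply summ_at_ps_one; auto). rewrite ev_ps_one. ring.
Qed.

(** If h m = 0, the multiples A z^m are annihilated by T, so that A R0^m <= 1
    for every A. *)
Lemma admissible_leading_zero (m : nat) (h : nat -> C) (R0 : R) : 0 <= R0 ->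
  bohr_admissible m h R0 -> h m = RtoC 0 -> (0 < m)%nat /\ R0 = 0.
Proof.
  intros HR0 Hadm Hm.
  (* A = 2 / R0^m would give 2 <= 1 if R0^m were not 0 *)
  assert (K : Cmod (RtoC (2 / R0 ^ m)) * R0 ^ m <= 1).
  { apply (majorant_monomial R0 _ m (monomial m (RtoC (2 / R0 ^ m)))); auto.
    { unfold monomial. destruct (Nat.eq_dec m m); congruence. }
    apply Hadm; auto using monomial_starts_at, monomial_convergent.
    - apply converges_analytic, opA_monomial_analytic.
    - apply sup_norm_le. intros z Hz. rewrite ps_eval_opA_monomial by auto.
      rewrite Hm, Cmult_0_l, Cmod_0. lra.
    - lra. }
  assert (Hp : R0 ^ m = 0).
  { destruct (Req_dec (R0 ^ m) 0) as [|Hne]; auto.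
    assert (0 <= R0 ^ m) by (apply pow_le; auto).
    rewrite Cmod_real in K by (apply Rdiv_le_0_compat; lra).
    replace (2 / R0 ^ m * R0 ^ m) with 2 in K by (field; auto). lra. }
  destruct m as [|m]; [simpl in Hp; lra|]. split; [lia|].
  destruct (Req_dec R0 0) as [|Hne]; auto. exfalso. apply (pow_nonzero R0 (S m)); auto.
Qed.

Lemma Cmod_mono_ge (m : nat) (h : nat -> C) :
  (forall n : nat, (m <= n)%nat -> Cmod (h n) <= Cmod (h (S n))) ->
  forall k n, (m <= k)%nat -> (k <= n)%nat -> Cmod (h k) <= Cmod (h n).
Proof.
  intros H k n Hk Hn. induction Hn as [|n Hn IH]; [lra|].
  eapply Rle_trans; [exact IH|]. apply H. lia.
Qed.

(** The series that T maps to [phi], when h has no zero coefficient from degree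
    m on. *)
Definition hadamard_preimage (m : nat) (h phi : nat -> C) : nat -> C :=
  fun n => if Nat.ltb n m then RtoC 0 else (phi (n - m)%nat / h n)%C.

Lemma hadamard_preimage_shift (m : nat) (h phi : nat -> C) (n : nat) :
  hadamard_preimage m h phi (n + m) = (phi n / h (n + m)%nat)%C.
Proof.
  unfold hadamard_preimage. assert (E : Nat.ltb (n + m) m = false) by (apply Nat.ltb_ge; lia).
  rewrite E. do 2 f_equal. lia.
Qed.

Lemma hadamard_preimage_starts_at (m : nat) (h phi : nat -> C) :
  starts_at m (hadamard_preimage m h phi).
Proof.
  intros n Hn. unfold hadamard_preimage. apply Nat.ltb_lt in Hn. rewrite Hn. reflexivity.
Qed.

Lemma hadamard_preimage_convergent (m : nat) (h phi : nat -> C) (c : R) : 0 < c ->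
  (forall n, c <= Cmod (h (n + m)%nat)) -> analytic_in 1 phi ->
  convergent (hadamard_preimage m h phi).
Proof.
  intros Hc Hh Hphi. exists 1. split; [lra|]. apply converges_analytic. intros r Hr.
  apply summ_at_shift with m; [lra|].
  apply (summ_at_dom _ phi (/ c) r r); [lra| |apply Hphi; auto].
  intros n. rewrite hadamard_preimage_shift. specialize (Hh n).
  rewrite Cmod_div by (apply Cmod_gt_0; lra).
  unfold Rdiv. rewrite (Rmult_comm (Cmod (phi n))), Rmult_assoc.
  apply Rmult_le_compat_r; [apply term_ge_0; lra|]. apply Rinv_le_contravar; auto.
Qed.

Lemma dominated_pair_dominates (m : nat) (h f g : nat -> C) :
  dominated_pair m h f g -> dominates 1 (opA m h f) (opA m h g).
Proof.
  intros [_ [_ [_ [_ [HF [HG Hd]]]]]]. apply converges_analytic in HF, HG.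
  split; [|split]; auto. intros z Hz. pose proof (Cmod_ge_0 z).
  rewrite <- !ps_eval_ev by (try apply HF; try apply HG; lra). auto.
Qed.

(** With Tf = phi Tg, the series with coefficients phi_k / h_(k+m) is mapped by
    T to phi, so its majorant series at r is at most 1. Coefficient n + m of f is a sum
    of products phi_k (Tg)_(n-k) / h_(n+m), and |h_(n+m)| >= |h_(k+m)| bounds
    it by the Cauchy product of that majorant series with the one of Tg. *)
Lemma majorant_dominated (m : nat) (h : nat -> C) (R0 : R) :
  (forall n : nat, (m <= n)%nat -> Cmod (h n) <= Cmod (h (S n))) ->
  h m <> RtoC 0 -> bohr_admissible m h R0 ->
  forall f g : nat -> C, dominated_pair m h f g -> forall r : R, 0 <= r <= R0 ->
  Rbar_le (majorant_series r f) (majorant_series r (opA m h g)).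
Proof.
  intros hmono Hm Hadm f g Hfg r Hr.
  pose proof (Cmod_mono_ge m h hmono) as Hmono.
  assert (Hc : 0 < Cmod (h m)) by (apply Cmod_gt_0; auto).
  assert (Hh : forall n, Cmod (h m) <= Cmod (h (n + m)%nat)) by (intros n; apply Hmono; lia).
  destruct (schur_quotient_exists _ _ (dominated_pair_dominates m h f g Hfg))
    as [phi [Aphi [Bphi Ephi]]].
  destruct Hfg as [Hf _].
  set (G := opA m h g) in *. set (ft := hadamard_preimage m h phi).
  assert (ET : forall n, opA m h ft n = phi n).
  { intros n. unfold opA, hadamard, ft. rewrite hadamard_preimage_shift. field.
    apply Cmod_gt_0. specialize (Hh n). lra. }
  assert (AT : analytic_in 1 (opA m h ft)).
  { intros s Hs. apply summ_at_ext with phi; auto. }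
  assert (Hft : Rbar_le (majorant_series r ft) (Finite 1)).
  { apply Hadm; auto.
    - apply hadamard_preimage_starts_at.
    - apply hadamard_preimage_convergent with (Cmod (h m)); auto.
    - apply converges_analytic; auto.
    - apply sup_norm_le. intros z Hz. pose proof (Cmod_ge_0 z).
      rewrite ps_eval_ev by (apply AT; lra). rewrite (ev_ext _ phi z ET). auto. }
  apply (majorant_le_shift r f G m). intros N.
  rewrite sum_shift by (intros n Hn; rewrite (Hf n Hn), Cmod_0; ring).
  set (al := fun k => Cmod (ft (k + m)%nat) * r ^ (k + m)).
  set (be := fun j => Cmod (G j) * r ^ j).
  assert (Hal : forall n, 0 <= al n) by (intros n; apply term_ge_0; lra).
  assert (Hbe : forall n, 0 <= be n) by (intros n; apply term_ge_0; lra).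
  assert (Sal : sum_f_R0 al N <= 1).
  { pose proof (majorant_partial_le r ft (N + m) 1 ltac:(lra) Hft) as K.
    rewrite sum_shift in K; auto.
    intros n Hn. unfold ft. rewrite hadamard_preimage_starts_at, Cmod_0 by auto. ring. }
  assert (Sbe : 0 <= sum_f_R0 be N) by (apply cond_pos_sum; auto).
  apply Rle_trans with (sum_f_R0 (convR al be) N).
  2: { eapply Rle_trans; [apply sum_convR_le; auto|].
       apply Rle_trans with (1 * sum_f_R0 be N); [apply Rmult_le_compat_r; auto|]. lra. }
  apply sum_Rle. intros n _.
  set (H := Cmod (h (n + m)%nat)). assert (HH : 0 < H) by (specialize (Hh n); fold H in Hh; lra).
  apply Rmult_le_reg_l with H; auto.
  assert (E : H * Cmod (f (n + m)%nat) = Cmod (conv phi G n)).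
  { rewrite Ephi. unfold opA, hadamard. rewrite Cmod_mult. reflexivity. }
  rewrite <- Rmult_assoc, E.
  apply Rle_trans with (convR (fun k => Cmod (phi k)) (fun k => Cmod (G k)) n * r ^ (n + m)).
  { apply Rmult_le_compat_r; [apply pow_le; lra | apply Cmod_conv_le]. }
  rewrite !convR_sum, (Rmult_comm (sum_f_R0 _ _)), !scal_sum.
  apply sum_Rle. intros k Hk. unfold al, be, ft. rewrite hadamard_preimage_shift.
  assert (Hk0 : 0 < Cmod (h (k + m)%nat)) by (specialize (Hh k); lra).
  rewrite Cmod_div by (apply Cmod_gt_0; auto).
  replace (n + m)%nat with ((k + m) + (n - k))%nat by lia. rewrite pow_add.
  (* the monotonicity of the moduli |h_n| enters here *)
  assert (Hquot : 1 <= H / Cmod (h (k + m)%nat)).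
  { apply Rmult_le_reg_r with (Cmod (h (k + m)%nat)); auto.
    unfold Rdiv. rewrite Rmult_assoc, Rinv_l by lra.
    rewrite Rmult_1_l, Rmult_1_r. apply Hmono; lia. }
  set (P := Cmod (phi k) * r ^ (k + m) * (Cmod (G (n - k)%nat) * r ^ (n - k))).
  assert (HP : 0 <= P).
  { apply Rmult_le_pos; apply term_ge_0 || apply Rmult_le_pos; try lra; try apply Cmod_ge_0.
    apply pow_le; lra. }
  replace (Cmod (phi k) * Cmod (G (n - k)%nat) * (r ^ (k + m) * r ^ (n - k))) with (P * 1) by (unfold P; ring).
  replace (Cmod (phi k) / Cmod (h (k + m)%nat) * r ^ (k + m) * (Cmod (G (n - k)%nat) * r ^ (n - k)) * H)
    with (P * (H / Cmod (h (k + m)%nat))) by (unfold P; field; lra).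
  apply Rmult_le_compat_l; auto.
Qed.

Lemma majorant_finite_support (r : R) (u : nat -> C) (m : nat) :
  (forall n, n <> m -> u n = RtoC 0) -> majorant_series r u = Finite (Cmod (u m) * r ^ m).
Proof.
  intros H. unfold majorant_series.
  rewrite <- (Lim_seq_incr_n _ m), <- (Lim_seq_const (Cmod (u m) * r ^ m)).
  apply Lim_seq_ext. intros n. rewrite sum_n_Reals, sum_shift.
  - induction n as [|n IH]; [reflexivity|]. rewrite tech5, IH, (H (S n + m)%nat) by lia. rewrite Cmod_0. ring.
  - intros k Hk. rewrite H by lia. rewrite Cmod_0. ring.
Qed.

Theorem theorem9 (m : nat) (h : nat -> C) (hh : starts_at m h)
  (hmono : forall n : nat, (m <= n)%nat -> Cmod (h n) <= Cmod (h (S n)))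
  (R0 : R) (hR0 : is_bohr_radius m h R0) :
  (forall f g : nat -> C, dominated_pair m h f g ->
     forall r : R, 0 <= r <= R0 ->
       Rbar_le (majorant_series r f) (majorant_series r (opA m h g)))
  /\
  (forall R1 : R, R0 < R1 ->
     ~ (forall f g : nat -> C, dominated_pair m h f g ->
          forall r : R, 0 <= r <= R1 ->
            Rbar_le (majorant_series r f) (majorant_series r (opA m h g)))).
Proof.
  destruct hR0 as [HR0 [Hadm Hmax]]. destruct (classic (h m = RtoC 0)) as [Hm|Hm].
  - destruct (admissible_leading_zero m h R0 HR0 Hadm Hm) as [Hmp ->].
    split.
    + intros f g [Hf _] r Hr. replace r with 0 by lra.
      apply majorant_le_shift with 1%nat. intros N.
      apply Rle_trans with 0.
      * right. apply sum_eq_R0. intros [|n] _.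
        -- rewrite (Hf O Hmp), Cmod_0. ring.
        -- simpl. ring.
      * apply cond_pos_sum. intros n. apply term_ge_0. lra.
    + intros R1 HR1 Hall.
      assert (Hpair : dominated_pair m h (monomial m (RtoC 1)) (monomial m (RtoC 0))).
      { repeat split; auto using monomial_starts_at, monomial_convergent;
          try (apply converges_analytic, opA_monomial_analytic).
        intros z Hz. rewrite !ps_eval_opA_monomial, Hm, !Cmult_0_l by auto. lra. }
      specialize (Hall _ _ Hpair R1 ltac:(lra)).
      rewrite (majorant_finite_support R1 (opA m h _) 0) in Hall.
      2: { intros n _. rewrite opA_monomial. ring. }
      apply (majorant_monomial R1 (RtoC 1) m) in Hall; [|lra|].
      2: { unfold monomial. destruct (Nat.eq_dec m m); congruence. }
      rewrite opA_monomial, Hm, !Cmult_0_l, Cmod_0, Cmod_1 in Hall.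
      pose proof (pow_lt R1 m HR1). lra.
  - split; [apply majorant_dominated; auto|].
    intros R1 HR1 Hall.
    assert (Hadm1 : bohr_admissible m h R1).
    { intros f Hf Cf Af Sf r Hr.
      assert (Hpair : dominated_pair m h f (monomial m (/ h m))).
      { repeat split; auto using monomial_starts_at, monomial_convergent;
          try (apply converges_analytic, opA_monomial_analytic).
        intros z Hz. rewrite ps_eval_opA_monomial by auto.
        replace (h m * / h m)%C with (RtoC 1) by (field; auto). rewrite Cmod_1.
        apply sup_norm_bound; auto. }
      specialize (Hall _ _ Hpair r Hr).
      rewrite (majorant_finite_support r (opA m h _) 0), opA_monomial in Hall.
      - replace (h m * / h m * ps_one 0)%C with (RtoC 1) in Hall by (simpl; field; auto).
        rewrite Cmod_1, Rmult_1_l in Hall. exact Hall.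
      - intros n Hn. rewrite opA_monomial. destruct n; [congruence|]. simpl. ring. }
    specialize (Hmax R1 ltac:(lra) Hadm1). lra.
Qed.
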